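(* There exist a computable basic sequence $Q=(q_n)_{n\ge1}$ and a computable real number $x$ such that $x\in[0,1)$ and $rx+s\in \mathcal{N}(Q)\setminus\mathcal{DN}(Q)$ for every $r\in\mathbb{Q}\setminus\{0\}$ and every $s\in\mathbb{Q}$.
   Context: A basic sequence is a sequence $Q=(q_n)_{n\ge1}$ of integers with $q_n\ge2$; it is computable if $n\mapsto q_n$ is a total recursive function. A real number $x$ is computable if for some integer $b\ge2$ there is a total recursive function computing the base-$b$ digits of $x$. Every real $x$ has a unique $Q$-Cantor series expansion $x=E_0+\sum_{n\ge1}\frac{E_n}{q_1\cdots q_n}$ with $E_0=\lfloor x\rfloor$, $E_n\in\{0,\dots,q_n-1\}$, $E_n\neq q_n-1$ infinitely often. A block of length $k$ is a $k$-tuple of non-negative integers; $N_n^Q(B,x)$ is the number of occurrences of $B$ as a consecutive block starting at some position $i\le n$ in $(E_i)$. Let $Q_n^{(k)}=\sum_{j=1}^n \frac{1}{q_j\cdots q_{j+k-1}}$. $x$ is $Q$-normal if for every $k\ge1$ and every block $B$ of length $k$, $N_n^Q(B,x)/Q_n^{(k)}\to1$; $\mathcal{N}(Q)$ is the set of $Q$-normal numbers. $x$ is $Q$-distribution normal if $((q_1\cdots q_n)x \bmod 1)_{n\ge0}$ is uniformly distributed mod $1$; $\mathcal{DN}(Q)$ is the set of these. *)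

(* Defs.v *)
From HB Require Import structures.
From mathcomp Require Import all_boot all_order all_algebra.
From mathcomp Require Import boolp classical_sets functions reals.
From mathcomp Require Import topology normedtype sequences.

Set Implicit Arguments.
Unset Strict Implicit.
Unset Printing Implicit Defensive.

Import Order.TTheory GRing.Theory Num.Theory.
Import numFieldNormedType.Exports.

Local Open Scope classical_set_scope.
Local Open Scope ring_scope.

(** Codes of k-ary partial (mu-)recursive functions. *)
Inductive recf : nat -> Type :=
| RZero k : recf k
| RSucc : recf 1
| RProj k (i : 'I_k) : recf k
| RComp m k (f : recf m) (g : 'I_m -> recf k) : recf k
| RPrec k (f : recf k) (g : recf k.+2) : recf k.+1
| RMin k (f : recf k.+1) : recf k.

(** [reval c v y]: the partial function coded by [c] is defined at [v], with
    value [y].  The recursion variable of [RPrec] and the search variable of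
    [RMin] come first; as usual for partial functions, [RMin f] at [v] has
    value [n] only if [f] is defined and nonzero at all [(m, v)], [m < n]. *)
Inductive reval : forall k, recf k -> k.-tuple nat -> nat -> Prop :=
| EvalZero k (v : k.-tuple nat) : reval (RZero k) v 0%N
| EvalSucc (v : 1.-tuple nat) : reval RSucc v (thead v).+1
| EvalProj k (i : 'I_k) (v : k.-tuple nat) : reval (RProj i) v (tnth v i)
| EvalComp m k (f : recf m) (g : 'I_m -> recf k) (v : k.-tuple nat)
    (w : m.-tuple nat) (y : nat) :
    (forall i, reval (g i) v (tnth w i)) -> reval f w y ->
    reval (RComp f g) v y
| EvalPrec0 k (f : recf k) (g : recf k.+2) (v : k.-tuple nat) (y : nat) :
    reval f v y -> reval (RPrec f g) (cons_tuple 0%N v) y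
| EvalPrecS k (f : recf k) (g : recf k.+2) (v : k.-tuple nat) (n z y : nat) :
    reval (RPrec f g) (cons_tuple n v) z ->
    reval g (cons_tuple n (cons_tuple z v)) y ->
    reval (RPrec f g) (cons_tuple n.+1 v) y
| EvalMin k (f : recf k.+1) (v : k.-tuple nat) (n : nat) (z : nat -> nat) :
    (forall m, (m < n)%N -> reval f (cons_tuple m v) (z m).+1) ->
    reval f (cons_tuple n v) 0%N ->
    reval (RMin f) v n.

Definition total_recursive (f : nat -> nat) : Prop :=
  exists c : recf 1, forall n, reval c [tuple n] (f n).

(** Sequences [(q_n)_{n >= 1}] are encoded as functions on [nat] whose value
    at [0] is irrelevant. *)
Definition basic_sequence (q : nat -> nat) : Prop :=
  forall n, (1 <= n)%N -> (2 <= q n)%N.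

Section CantorSeries.
Variable R : realType.
Implicit Types (q E : nat -> nat) (x : R).

(** [qprod q i k] is [q_i q_(i+1) ... q_(i+k-1)]. *)
Definition qprod q (i k : nat) : R := \prod_(i <= l < i + k) (q l)%:R.

(** [E_0] is kept apart from the digits [E_n], [n >= 1], as it is a signed
    integer; [E 0] is irrelevant. *)
Definition cantor_expansion q x (E0 : int) E : Prop :=
  [/\ E0 = Num.floor x,
      (forall n, (1 <= n)%N -> (E n <= q n - 1)%N),
      (forall m, exists2 n, (m < n)%N & E n <> (q n - 1)%N)
    & (fun N : nat =>
         E0%:~R + \sum_(1 <= n < N.+1) (E n)%:R / qprod q 1 n) @ \oo --> x].

(** The base-b expansion is the Cantor series expansion for the constant
    basic sequence [b]. The integer part, a single integer, needs no
    computability condition. *)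
Definition computable_real x : Prop :=
  exists b : nat, (2 <= b)%N /\
  exists (E0 : int) (E : nat -> nat),
    cantor_expansion (fun=> b) x E0 E /\ total_recursive E.

Definition block_occ k (B : k.-tuple nat) E (n : nat) : nat :=
  count (fun i => [forall j : 'I_k, E (i + j)%N == tnth B j]) (iota 1 n).

Definition Qsum q (k n : nat) : R := \sum_(1 <= j < n.+1) (qprod q j k)^-1.

(** The expansion of [x] exists and is unique when [q] is basic. *)
Definition normal_numbers q : set R :=
  [set x | exists (E0 : int) (E : nat -> nat),
    cantor_expansion q x E0 E /\
    forall k (B : k.-tuple nat), (1 <= k)%N ->
      (fun n : nat => (block_occ B E n)%:R / Qsum q k n) @ \oo --> (1 : R)].

Definition fracp x : R := x - (Num.floor x)%:~R.

(** The sequence is indexed from [0]. *)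
Definition uniformly_distributed_mod1 (u : nat -> R) : Prop :=
  forall a b : R, 0 <= a -> a < b -> b <= 1 ->
    (fun N : nat =>
       (count (fun n => a <= fracp (u n) < b) (iota 0 N))%:R / N%:R : R)
      @ \oo --> b - a.

Definition distribution_normal_numbers q : set R :=
  [set x | uniformly_distributed_mod1 (fun n => qprod q 1 n * x)].

End CantorSeries.

(* Main.v *)
Require Import Defs.
From HB Require Import structures.
From mathcomp Require Import all_boot all_order all_algebra.
From mathcomp Require Import boolp classical_sets functions reals.
From mathcomp Require Import topology normedtype sequences landau.
From mathcomp Require Import zify ring lra.

(** Write [P_n = q_1 ... q_n] and let [T_n(z)] be the fractional part of
    [P_n z].  Most positions are fillers, with [q_n = (n+1)!] and digit [n!];
    between them stand rare words of length [g] in a slowly growing even base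
    [Q = 2g+2], which run periodically through all [V = Q^g] words.

    Let [y = rho x + sigma] with [rho <> 0] and [sigma] rational.  At a late
    filler, the common denominator of [rho] and [sigma] divides [P_n] and
    [P_n x - T_n(x)], so [T_n(y)] is the fractional part of [rho T_n(x)].
    - If the next position is a filler too, [T_n(x)] is small and [T_n(y)] is
      close to [0] or [1]; fillers have density one, so [y] is not distribution
      normal.
    - If [n] is a filler, [T_(n-1)(x)] is about [1/n], and the denominator of
      [rho] and [sigma] keeps [T_(n-1)(y)] above [|rho| T_(n-1)(x)].  Hence the
      digits of [y] at fillers tend to infinity; as the weights [1/q_n] of
      fillers are summable, fillers do not affect the frequencies of blocks.
    - Inside the word number [W], [T(y)] after [e] letters is the fractional
      part of [rho Q^e (W + theta) / V] with [0 <= theta < 1].  As [W] runs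
      through [0, ..., V-1], it falls in an interval of length [Q^-k] with
      frequency [Q^-k], up to an error whose sum over [e] is [O(Q^-k)], which
      is negligible because there are [g-k+1] choices of [e].

    Passing from one run through the words to the sums up to [n] is an
    application of the Stolz-Cesaro theorem.

    As all [q_n] are even, [2^n] divides [P_n], and the first [n] bits of [x]
    can be read off the [n]-th partial sum of its Cantor series. *)

Set Implicit Arguments.
Unset Strict Implicit.
Unset Printing Implicit Defensive.

(** * Recursive functions *)

Definition recursive k (F : k.-tuple nat -> nat) : Prop :=
  exists c : recf k, forall v, reval c v (F v).

Lemma eq_recursive k (F G : k.-tuple nat -> nat) :
  F =1 G -> recursive F -> recursive G.
Proof. by move=> eqFG [c cF]; exists c => v; rewrite -eqFG. Qed.

Lemma recursive_proj k (i : 'I_k) : recursive (fun v => tnth v i).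
Proof. by exists (RProj i) => v; exact: EvalProj. Qed.

Lemma recursive_comp m k (F : m.-tuple nat -> nat)
    (G : 'I_m -> k.-tuple nat -> nat) :
  recursive F -> (forall i, recursive (G i)) ->
  recursive (fun v => F [tuple G i v | i < m]).
Proof.
move=> [c cF] /choice [d dG]; exists (RComp c d) => v.
apply: (@EvalComp _ _ _ _ _ [tuple G i v | i < m]) => // i.
by rewrite tnth_mktuple.
Qed.

Lemma recursive_prec k (F : k.-tuple nat -> nat) (G : k.+2.-tuple nat -> nat)
    (u : nat -> k.-tuple nat -> nat) :
  recursive F -> recursive G -> (forall v, u 0 v = F v) ->
  (forall n v, u n.+1 v = G (cons_tuple n (cons_tuple (u n v) v))) ->
  recursive (fun v : k.+1.-tuple nat => u (thead v) (behead_tuple v)).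
Proof.
move=> [c cF] [d dG] u0 uS; exists (RPrec c d) => v.
have [n [w ->]] : exists n w, v = cons_tuple n w.
  by exists (thead v), (behead_tuple v); apply: val_inj; case: v => -[].
have -> : behead_tuple (cons_tuple n w) = w :> k.-tuple nat by exact: val_inj.
rewrite theadE; elim: n => [|n IHn]; first by rewrite u0; exact: EvalPrec0.
by rewrite uS; exact: EvalPrecS IHn _.
Qed.

Lemma total_recursiveP (f : nat -> nat) :
  total_recursive f <-> recursive (fun v : 1.-tuple nat => f (tnth v ord0)).
Proof.
split=> -[c cf]; exists c; last by move=> n; exact: (cf [tuple n]).
move=> v; rewrite [X in reval c X](_ : v = [tuple tnth v ord0]) //.
by apply/eq_from_tnth => i; rewrite (ord1 i).
Qed.

Lemma recursive_app (f : nat -> nat) k (F : k.-tuple nat -> nat) :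
  total_recursive f -> recursive F -> recursive (fun v => f (F v)).
Proof.
move=> /total_recursiveP rf rF.
apply: eq_recursive (recursive_comp rf (fun=> rF)) => v.
by rewrite tnth_mktuple.
Qed.

Lemma recursive_succ k (F : k.-tuple nat -> nat) :
  recursive F -> recursive (fun v => (F v).+1).
Proof.
by apply: recursive_app; exists RSucc => n; exact: (EvalSucc [tuple n]).
Qed.

Lemma recursive_const k (a : nat) : recursive (fun _ : k.-tuple nat => a).
Proof.
elim: a => [|a IHa]; last exact: recursive_succ.
by exists (RZero k) => v; exact: EvalZero.
Qed.

Lemma total_recursive_prec (u : nat -> nat) (g : nat -> nat -> nat) :
  (forall k (F G : k.-tuple nat -> nat),
    recursive F -> recursive G -> recursive (fun v => g (F v) (G v))) ->
  (forall n, u n.+1 = g n (u n)) -> total_recursive u.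
Proof.
move=> rg uS; apply/total_recursiveP.
apply: (eq_recursive (F := fun v : 1.-tuple nat => u (thead v))) => //.
have rg_proj := rg 2 _ _ (recursive_proj ord0) (recursive_proj ord_max).
exact: (recursive_prec (u := fun n=> fun=> u n)
  (recursive_const 0 (u 0)) rg_proj).
Qed.

Lemma recursive_prec2 (u : nat -> nat -> nat) (f : nat -> nat)
    (g : nat -> nat -> nat -> nat) :
  (forall k (F : k.-tuple nat -> nat), recursive F ->
    recursive (fun v => f (F v))) ->
  (forall k (F G H : k.-tuple nat -> nat), recursive F -> recursive G ->
    recursive H -> recursive (fun v => g (F v) (G v) (H v))) ->
  (forall b, u 0 b = f b) -> (forall n b, u n.+1 b = g n (u n b) b) ->
  forall k (F G : k.-tuple nat -> nat),
    recursive F -> recursive G -> recursive (fun v => u (F v) (G v)).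
Proof.
move=> rf rg u0 uS k F G rF rG.
have ru : recursive (fun w : 2.-tuple nat => u (tnth w ord0) (tnth w ord_max)).
  apply: eq_recursive (recursive_prec (u := fun n (w : 1.-tuple nat) =>
    u n (tnth w ord0)) (rf 1 _ (recursive_proj ord0))
    (rg 3 _ _ _ (recursive_proj ord0) (recursive_proj (lift ord0 ord0))
       (recursive_proj ord_max)) _ _) => [w|//|n w].
    by rewrite /thead !(tnth_nth 0) nth_behead.
  by rewrite uS !(tnth_nth 0).
apply: eq_recursive (recursive_comp ru
  (G := fun i => if i == ord0 then F else G) _) => [v|i]; last by case: ifP.
by rewrite !tnth_mktuple.
Qed.

Lemma recursive_add k (F G : k.-tuple nat -> nat) :
  recursive F -> recursive G -> recursive (fun v => F v + G v).
Proof.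
apply: (@recursive_prec2 _ id (fun _ z _ => z.+1)) => // *.
exact: recursive_succ.
Qed.

Lemma recursive_mul k (F G : k.-tuple nat -> nat) :
  recursive F -> recursive G -> recursive (fun v => F v * G v).
Proof.
apply: (@recursive_prec2 _ (fun=> 0) (fun _ z b => b + z)) => // *.
  exact: recursive_const.
exact: recursive_add.
Qed.

Lemma recursive_exp k (F G : k.-tuple nat -> nat) :
  recursive F -> recursive G -> recursive (fun v => F v ^ G v).
Proof.
move=> rF rG; apply: (@recursive_prec2 (fun b a => a ^ b) (fun=> 1)
  (fun _ z a => a * z)) rG rF => // *; first exact: recursive_const.
- exact: recursive_mul.
- exact: expnS.
Qed.

Lemma recursive_pred k (F : k.-tuple nat -> nat) :
  recursive F -> recursive (fun v => (F v).-1).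
Proof.
by apply: recursive_app; exact: (@total_recursive_prec _ (fun n _ => n)).
Qed.

Lemma recursive_sub k (F G : k.-tuple nat -> nat) :
  recursive F -> recursive G -> recursive (fun v => F v - G v).
Proof.
move=> rF rG; apply: (@recursive_prec2 (fun b a => a - b) id
  (fun _ z _ => z.-1)) rG rF => // *.
- exact: recursive_pred.
- exact: subn0.
- exact: subnS.
Qed.

Lemma recursive_leq k (F G : k.-tuple nat -> nat) :
  recursive F -> recursive G -> recursive (fun v => (F v <= G v) : nat).
Proof.
move=> rF rG; apply: (@eq_recursive _ (fun v => 1 - (F v - G v))).
  by move=> v; lia.
exact: recursive_sub (recursive_const _ _) (recursive_sub rF rG).
Qed.

Lemma recursive_eqn k (F G : k.-tuple nat -> nat) :
  recursive F -> recursive G -> recursive (fun v => (F v == G v) : nat).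
Proof.
move=> rF rG; apply: (@eq_recursive _ (fun v => (F v <= G v) * (G v <= F v))).
  by move=> v; rewrite mulnb -eqn_leq.
exact: recursive_mul (recursive_leq rF rG) (recursive_leq rG rF).
Qed.

Lemma recursive_mod k (F G : k.-tuple nat -> nat) :
  recursive F -> recursive G -> recursive (fun v => F v %% G v).
Proof.
apply: (@recursive_prec2 _ (fun=> 0)
  (fun _ z b => z.+1 * (1 - (z.+1 == b)))) => //.
- by move=> *; exact: recursive_const.
- move=> m H K L rH rK rL.
  apply: recursive_mul; first exact: recursive_succ.
  apply: recursive_sub; first exact: recursive_const.
  exact: recursive_eqn (recursive_succ rK) rL.
- exact: mod0n.
- move=> n [|b]; first by rewrite !modn0 muln1.
  rewrite -[n.+1]addn1 -modnDml addn1; case: eqVneq => [->|neq_b].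
    by rewrite modnn muln0.
  by rewrite muln1 modn_small // ltn_neqAle neq_b ltn_mod.
Qed.

Lemma recursive_div k (F G : k.-tuple nat -> nat) :
  recursive F -> recursive G -> recursive (fun v => F v %/ G v).
Proof.
apply: (@recursive_prec2 _ (fun=> 0) (fun n z b => (n.+1 %% b == 0) + z)) => //.
- by move=> *; exact: recursive_const.
- move=> m H K L rH rK rL; apply: recursive_add rK.
  apply: recursive_eqn (recursive_const _ _).
  exact: recursive_mod (recursive_succ rH) rL.
- exact: div0n.
- by move=> n [|b]; [rewrite !divn0 modn0|rewrite divnS].
Qed.

Lemma recursive_fact k (F : k.-tuple nat -> nat) :
  recursive F -> recursive (fun v => (F v)`!).
Proof.
apply: recursive_app.
apply: (@total_recursive_prec _ (fun n z => n.+1 * z)) => //.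
by move=> m H K rH rK; exact: recursive_mul (recursive_succ rH) rK.
Qed.

Lemma recursive_if k (p : k.-tuple nat -> bool) (F G : k.-tuple nat -> nat) :
  recursive p -> recursive F -> recursive G ->
  recursive (fun v => if p v then F v else G v).
Proof.
move=> rp rF rG.
apply: (@eq_recursive _ (fun v => p v * F v + (1 - p v) * G v)).
  by move=> v; case: (p v); rewrite !mul1n mul0n ?addn0.
apply: recursive_add; first exact: recursive_mul.
exact: recursive_mul (recursive_sub (recursive_const _ _) rp) rG.
Qed.

(** For [h] increasing with [h 0 = 0], the largest [m] with [h m <= n]. *)
Fixpoint lower_inverse (h : nat -> nat) (n : nat) : nat :=
  if n is m.+1 then
    lower_inverse h m + (h (lower_inverse h m).+1 <= m.+1)
  else 0.

Lemma total_recursive_lower_inverse (h : nat -> nat) :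
  total_recursive h -> total_recursive (lower_inverse h).
Proof.
move=> rh.
apply: (@total_recursive_prec _ (fun n z => z + (h z.+1 <= n.+1))) => //.
move=> k F G rF rG; apply: recursive_add => //.
exact: recursive_leq (recursive_app rh (recursive_succ rG)) (recursive_succ rF).
Qed.

Section LowerInverse.
Variable h : nat -> nat.
Hypotheses (h0 : h 0 = 0) (h_lt : forall n, h n < h n.+1).

Lemma lower_inverse_itv n :
  h (lower_inverse h n) <= n < h (lower_inverse h n).+1.
Proof.
elim: n => [|n /andP[le_n n_lt]] /=; first by rewrite h0 -[X in X < _]h0 h_lt.
case: (leqP (h (lower_inverse h n).+1) n.+1) => [le_nS|lt_nS] /=.
  by rewrite addn1 le_nS (leq_ltn_trans n_lt).
by rewrite addn0 lt_nS (leq_trans le_n).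
Qed.

Lemma leq_lower_inverse m n : (m <= lower_inverse h n) = (h m <= n).
Proof.
have h_mono : {mono h : a b / a <= b} by apply/leq_mono/(homo_ltn ltn_trans).
have /andP[le_n n_lt] := lower_inverse_itv n.
apply/idP/idP => [|le_hm]; first by rewrite -h_mono => /leq_trans->.
by rewrite -ltnS -(leqW_mono h_mono) (leq_ltn_trans le_hm).
Qed.

Lemma leq_lower_inverse2 m n : m <= n -> lower_inverse h m <= lower_inverse h n.
Proof.
move=> le_mn; rewrite leq_lower_inverse (leq_trans _ le_mn) //.
by have /andP[] := lower_inverse_itv m.
Qed.
End LowerInverse.

(** [numer q E n / denom q n] is the [n]-th partial sum of the Cantor series
    with basic sequence [q] and digits [E]. *)
Fixpoint denom (q : nat -> nat) n :=
  if n is m.+1 then q m.+1 * denom q m else 1.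

Fixpoint numer (q E : nat -> nat) n :=
  if n is m.+1 then q m.+1 * numer q E m + E m.+1 else 0.

Definition radix_digit b (q E : nat -> nat) n :=
  (b ^ n * numer q E n) %/ denom q n %% b.

Lemma total_recursive_denom q : total_recursive q -> total_recursive (denom q).
Proof.
move=> rq; apply: (@total_recursive_prec _ (fun n z => q n.+1 * z)) => //.
move=> k F G /recursive_succ rF rG.
exact: recursive_mul (recursive_app rq rF) rG.
Qed.

Lemma total_recursive_numer q E :
  total_recursive q -> total_recursive E -> total_recursive (numer q E).
Proof.
move=> rq rE.
apply: (@total_recursive_prec _ (fun n z => q n.+1 * z + E n.+1)) => //.
move=> k F G /recursive_succ rF rG.
apply: recursive_add (recursive_app rE rF).
exact: recursive_mul (recursive_app rq rF) rG.
Qed.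

Lemma total_recursive_radix_digit b q E :
  total_recursive q -> total_recursive E -> total_recursive (radix_digit b q E).
Proof.
move=> rq rE; apply/total_recursiveP; have rn := recursive_proj (@ord0 0).
apply: recursive_mod (recursive_const _ _).
apply: recursive_div (recursive_app (total_recursive_denom rq) rn).
apply: recursive_mul (recursive_exp (recursive_const _ _) rn) _.
exact: recursive_app (total_recursive_numer rq rE) rn.
Qed.

Import Order.TTheory GRing.Theory Num.Theory.
Import numFieldNormedType.Exports.
Local Open Scope classical_set_scope.
Local Open Scope ring_scope.

(** * Cantor series expansions *)

Section FractionalPart.
Variable R : realType.
Implicit Types (x y t : R) (z : int).

Lemma fracp_itv x : 0 <= fracp x < 1.
Proof.
by have := floor_itv x; rewrite /fracp intrD subr_ge0 ltrBlDl => /andP[-> ->].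
Qed.

Lemma fracpDz x z : fracp (x + z%:~R) = fracp x.
Proof. by rewrite /fracp floorDrz ?intr_int // intrKfloor intrD; ring. Qed.

Lemma fracp_id x : 0 <= x < 1 -> fracp x = x.
Proof. by move=> x_itv; rewrite /fracp (floor_def (m := 0)) ?subr0. Qed.

Lemma fracp_def x z t : x = z%:~R + t -> 0 <= t < 1 -> fracp x = t.
Proof. by move=> ->; rewrite addrC fracpDz; exact: fracp_id. Qed.

Lemma fracp_truncn x : 0 <= x -> fracp x = x - (Num.truncn x)%:R.
Proof.
move=> /truncn_itv /andP[le_x]; rewrite -natr1 => x_lt.
by apply: (@fracp_def _ (Num.truncn x)); rewrite -?pmulrn; lra.
Qed.

Lemma fracpD_fracp x y : fracp (x + fracp y) = fracp (x + y).
Proof. by rewrite {2}/fracp addrA -intrN fracpDz. Qed.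

Lemma fracpM_nat n x : fracp (n%:R * fracp x) = fracp (n%:R * x).
Proof.
have -> : n%:R * fracp x = n%:R * x + (- (n%:Z * Num.floor x))%:~R.
  by rewrite /fracp mulrBr intrN intrM.
exact: fracpDz.
Qed.

Lemma fracp_near_int x (e : R) : `|x| < e -> ~~ (e <= fracp x < 1 - e).
Proof.
rewrite ltr_norml => /andP[x_gt x_lt]; apply/negP => /andP[].
have [e_ge1|e_lt1] := lerP 1 e; first by have := fracp_itv x; lra.
have [x_lt0|x_ge0] := ltrP x 0; last by rewrite fracp_id; lra.
by rewrite (@fracp_def x (-1) (x + 1)) ?intrN; lra.
Qed.

Lemma fracp_rat_add_ge (d : nat) (u : int) (e : R) :
  (0 < d)%N -> `|e| * 2 <= d%:R^-1 -> `|e| <= fracp (u%:~R / d%:R + e).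
Proof.
move=> d_gt0 e_small; have d_gt0R : 0 < d%:R :> R by rewrite ltr0n.
have := fracp_itv (u%:~R / d%:R + e); rewrite /fracp.
set f := Num.floor _.
have -> : u%:~R / d%:R + e - f%:~R = (u - d%:Z * f)%:~R / d%:R + e.
  by rewrite intrB intrM -pmulrn; field; exact: lt0r_neq0.
have := ler_norm e; have := ler_norm (- e); rewrite normrN.
move: (u - _) => v Ne_le e_le /andP[v_ge v_lt].
have [v_gt0|v_lt0|v_eq0] := ltrgtP 0 v.
- have : 1 / d%:R <= v%:~R / d%:R :> R.
    by rewrite ler_pM2r ?invr_gt0 // (ler_int R 1).
  by lra.
- have : v%:~R / d%:R <= -1 / d%:R :> R.
    by rewrite ler_pM2r ?invr_gt0 // (ler_int R _ (-1)); lia.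
  by have : 0 < d%:R^-1 :> R; [rewrite invr_gt0|lra].
- by move: v_ge; rewrite -v_eq0 mulr0z mul0r add0r => /ger0_norm ->.
Qed.
End FractionalPart.

Section CantorDigits.
Variable R : realType.
Implicit Type y : R.

Definition cantor_digit (q : nat -> nat) y n : nat :=
  Num.truncn ((q n)%:R * fracp (qprod R q 1 n.-1 * y)).

Lemma qprod0 q i : qprod R q i 0 = 1.
Proof. by rewrite /qprod addn0 big_geq. Qed.

Lemma qprodS q i n : qprod R q i n.+1 = qprod R q i n * (q (i + n)%N)%:R.
Proof. by rewrite /qprod addnS big_nat_recr //= leq_addr. Qed.

Lemma qprod_const q i n b :
  (forall j, (j < n)%N -> q (i + j)%N = b) -> qprod R q i n = b%:R ^+ n.
Proof.
elim: n => [|n IHn] qb; first by rewrite qprod0.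
by rewrite qprodS exprSr IHn ?qb // => j jn; rewrite qb // ltnW.
Qed.

Variable q : nat -> nat.
Hypothesis q_ge2 : basic_sequence q.

Lemma qprod_gt0 i n : (0 < i)%N -> 0 < qprod R q i n.
Proof.
move=> i_gt0; elim: n => [|n IHn]; first by rewrite qprod0.
by rewrite qprodS mulr_gt0 // ltr0n (ltn_trans _ (q_ge2 _)) // addn_gt0 i_gt0.
Qed.

Lemma qprod_ge_pow2 n : 2 ^+ n <= qprod R q 1 n.
Proof.
elim: n => [|n IHn]; first by rewrite qprod0.
by rewrite qprodS exprSr ler_pM ?exprn_ge0 // (ler_nat R 2) q_ge2.
Qed.

Lemma qprod_ge_factor i n j :
  (0 < i)%N -> (j < n)%N -> (q (i + j)%N)%:R <= qprod R q i n.
Proof.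
move=> i_gt0; have q_ge1 m : 1 <= (q (i + m)%N)%:R :> R.
  by rewrite ler1n (ltn_trans _ (q_ge2 _)) // addn_gt0 i_gt0.
have qprod_ge1 m : 1 <= qprod R q i m.
  by elim: m => [|m IHm]; rewrite ?qprod0 // qprodS mulr_ege1.
elim: n => // n IHn; rewrite ltnS leq_eqVlt qprodS => /predU1P[->|jn].
  by rewrite ler_peMl // (le_trans ler01).
by rewrite (le_trans (IHn jn)) // ler_peMr // (le_trans ler01).
Qed.

Lemma cantor_digit_fracp y n :
  (q n.+1)%:R * fracp (qprod R q 1 n * y) =
  (cantor_digit q y n.+1)%:R + fracp (qprod R q 1 n.+1 * y).
Proof.
have /andP[t_ge0 _] := fracp_itv (qprod R q 1 n * y).
rewrite /cantor_digit /= qprodS add1n [_ * (q _)%:R]mulrC -mulrA -fracpM_nat.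
by rewrite (fracp_truncn (x := _ * fracp _)) ?mulr_ge0 // addrC subrK.
Qed.

Lemma cantor_digit_le y n : (1 <= n)%N -> (cantor_digit q y n <= q n - 1)%N.
Proof.
move=> n_gt0; have qn_ge2 := q_ge2 n_gt0.
have /andP[t_ge0 t_lt1] := fracp_itv (qprod R q 1 n.-1 * y).
rewrite -ltnS subn1 prednK ?truncn_lt_nat ?mulr_ge0 //; last by lia.
by rewrite gtr_pMr // ltr0n; lia.
Qed.

Lemma cantor_digit_sum y n :
  \sum_(1 <= i < n.+1) (cantor_digit q y i)%:R / qprod R q 1 i =
  y - (Num.floor y)%:~R - fracp (qprod R q 1 n * y) / qprod R q 1 n.
Proof.
elim: n => [|n IHn].
  by rewrite big_geq // qprod0 mul1r divr1 /fracp subrr.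
have digitE : (cantor_digit q y n.+1)%:R =
    (q n.+1)%:R * fracp (qprod R q 1 n * y) - fracp (qprod R q 1 n.+1 * y).
  by rewrite cantor_digit_fracp addrK.
have := @qprod_gt0 1 n.+1 isT; have := @qprod_gt0 1 n isT.
rewrite big_nat_recr //= IHn digitE qprodS add1n.
move=> /lt0r_neq0 P_neq0 /lt0r_neq0.
by rewrite mulf_eq0 negb_or => /andP[_ q_neq0]; field; rewrite ?P_neq0 ?q_neq0.
Qed.

(** If all digits after the [m]-th were maximal, [1 - fracp (q_1 ... q_n y)]
    would be multiplied by [q_(n+1) >= 2] at each step [n >= m]. *)
Lemma cantor_digit_neq_pred y m :
  exists2 n, (m < n)%N & cantor_digit q y n <> (q n - 1)%N.
Proof.
apply: contrapT => no_digit; pose t n := 1 - fracp (qprod R q 1 n * y).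
have t_itv n : 0 < t n <= 1.
  by have := fracp_itv (qprod R q 1 n * y); rewrite /t; lra.
have /andP[tm_gt0 _] := t_itv m.
have t_double k : 2 ^+ k * t m <= t (m + k)%N.
  elim: k => [|k IHk]; first by rewrite expr0 mul1r addn0.
  have qS_ge2 := @q_ge2 (m + k).+1 isT.
  have digit_max : cantor_digit q y (m + k).+1 = (q (m + k).+1 - 1)%N.
    apply: contrapT => neq_pred; apply: no_digit; exists (m + k).+1 => //.
    by rewrite ltnS leq_addr.
  have tS : (q (m + k).+1)%:R * t (m + k)%N = t (m + k).+1.
    have := cantor_digit_fracp y (m + k).
    by rewrite digit_max natrB ?(ltnW qS_ge2) // /t; lra.
  rewrite addnS -tS exprS -mulrA.
  by rewrite ler_pM ?(ler_nat R 2) ?mulr_ge0 ?exprn_ge0 ?(ltW tm_gt0).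
have := upper_nthrootP (leqnn (Num.bound (t m)^-1)); rewrite -(ltr_pM2r tm_gt0).
rewrite mulVf ?lt0r_neq0 // ltNge; case/negP.
rewrite (le_trans (t_double _)) //.
by have /andP[] := t_itv (m + Num.bound (t m)^-1)%N.
Qed.

Lemma cantor_series_cvg y :
  (fun n : nat => (Num.floor y)%:~R +
     \sum_(1 <= i < n.+1) (cantor_digit q y i)%:R / qprod R q 1 i) @ \oo --> y.
Proof.
rewrite (_ : (fun n => _) =
    fun n => y - fracp (qprod R q 1 n * y) / qprod R q 1 n); last first.
  by apply/funext => n; rewrite cantor_digit_sum; ring.
rewrite -[X in _ --> X]subr0; apply: cvgB; first exact: cvg_cst.
have half_lt1 : `|2^-1 : R| < 1 by rewrite ger0_norm; lra.
apply: (squeeze_cvgr _ (cvg_cst 0) (cvg_expr half_lt1)); near=> n.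
have /andP[t_ge0 t_lt1] := fracp_itv (qprod R q 1 n * y).
have P_gt0 := @qprod_gt0 1 n isT.
rewrite divr_ge0 ?(ltW P_gt0) //= exprVn ler_pdivrMr //.
rewrite (le_trans (ltW t_lt1)) //.
by rewrite ler_pdivlMl ?exprn_gt0 // mulr1 qprod_ge_pow2.
Unshelve. all: by end_near. Qed.

Lemma eq_cantor_expansion y z E E' :
  (forall n, (1 <= n)%N -> E n = E' n) ->
  cantor_expansion q y z E -> cantor_expansion q y z E'.
Proof.
move=> eqE [zE E_le E_neq E_cvg]; split=> //.
- by move=> n n_gt0; rewrite -eqE ?E_le.
- move=> m; have [n mn En] := E_neq m; exists n => //.
  by rewrite -eqE ?(leq_trans _ mn).
rewrite (_ : (fun n => _) = fun n : nat =>
  z%:~R + \sum_(1 <= i < n.+1) (E i)%:R / qprod R q 1 i) //; apply/funext => n.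
by congr (_ + _); apply: eq_big_nat => i /andP[i_gt0 _]; rewrite eqE.
Qed.

Lemma cantor_expansionP y :
  cantor_expansion q y (Num.floor y) (cantor_digit q y).
Proof.
split=> //; [exact: cantor_digit_le|exact: cantor_digit_neq_pred|].
exact: cantor_series_cvg.
Qed.
End CantorDigits.

Section Cylinders.
Variable R : realType.

Fixpoint cylinder_left (b : nat) (B : seq nat) : R :=
  if B is c :: B' then (c%:R + cylinder_left b B') / b%:R else 0.

Lemma cylinder_left_itv b B : (0 < b)%N -> all (fun c => c < b)%N B ->
  0 <= cylinder_left b B <= 1 - (b%:R ^+ size B)^-1.
Proof.
move=> b_gt0; elim: B => [|c B IHB] /=; first by rewrite expr0 invr1 subrr lexx.
move=> /andP[c_lt /IHB/andP[left_ge0 left_le]].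
have b_gt0R : 0 < b%:R :> R by rewrite ltr0n.
rewrite divr_ge0 ?addr_ge0 //= exprS invfM lerBrDr [b%:R^-1 * _]mulrC -mulrDl.
by rewrite ler_pdivrMr // mul1r; move: c_lt; rewrite -(ler_nat R) -natr1; lra.
Qed.

Lemma cantor_block_cylinder (q : nat -> nat) (y : R) b B m :
  (0 < b)%N -> all (fun c => c < b)%N B ->
  (forall j, (j < size B)%N -> q (m.+1 + j)%N = b) ->
  (forall j, (j < size B)%N -> cantor_digit q y (m.+1 + j) = nth 0%N B j) <->
  cylinder_left b B <= fracp (qprod R q 1 m * y)
    < cylinder_left b B + (b%:R ^+ size B)^-1.
Proof.
move=> b_gt0; have b_gt0R : 0 < b%:R :> R by rewrite ltr0n.
elim: B m => [|c B IHB] m /=.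
  by move=> _ _; rewrite expr0 invr1 add0r fracp_itv; split.
move=> /andP[c_lt B_lt] qE; have := cylinder_left_itv b_gt0 B_lt.
have qSE j : (j < size B)%N -> q (m.+2 + j)%N = b.
  by move=> jB; rewrite addSnnS qE.
have {IHB qSE} IHB := IHB m.+1 B_lt qSE.
have := cantor_digit_fracp q y m; rewrite -{1}[m.+1]addn0 (qE 0%N) //.
have := fracp_itv (qprod R q 1 m.+1 * y).
move: IHB; set t' := fracp (_ * _); move: (fracp (qprod R q 1 m * y)) => t.
move=> IHB t'_itv tE left_itv.
rewrite exprS invfM [b%:R^-1 * _]mulrC -mulrDl ler_pdivrMr // ltr_pdivlMr //.
rewrite [t * _]mulrC tE; split=> [digitsE|cyl].
  have -> : cantor_digit q y m.+1 = c by have := digitsE 0%N isT; rewrite addn0.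
  have /IHB : forall j, (j < size B)%N ->
      cantor_digit q y (m.+2 + j) = nth 0%N B j.
    by move=> j jB; have := digitsE j.+1 jB; rewrite -addSnnS.
  by lra.
have digitE : cantor_digit q y m.+1 = c.
  apply/eqP; rewrite eqn_leq -ltnS -[(c <= _)%N]ltnS -!(ltr_nat R) -!natr1.
  by lra.
move=> [_|j jB]; first by rewrite addn0.
by rewrite -addSnnS /=; apply: (IHB.2 _ j jB); move: cyl; rewrite digitE; lra.
Qed.
End Cylinders.

Section Occurrences.
Variable R : pzRingType.

Definition occurs k (B : k.-tuple nat) (E : nat -> nat) i : bool :=
  [forall j : 'I_k, E (i + j)%N == tnth B j].

Lemma natr_count_iota (p : pred nat) m n :
  (count p (iota m n))%:R = \sum_(m <= i < m + n) (p i)%:R :> R.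
Proof.
rewrite -sum1_count natr_sum big_mkcond /= /index_iota addKn.
by apply: eq_bigr => i _; case: (p i).
Qed.

Lemma block_occ_sum k (B : k.-tuple nat) E n :
  (block_occ B E n)%:R = \sum_(1 <= i < n.+1) (occurs B E i)%:R :> R.
Proof. exact: natr_count_iota. Qed.
End Occurrences.

Lemma qprod_denom (R : realType) q n : qprod R q 1 n = (denom q n)%:R.
Proof.
by elim: n => [|n IHn]; rewrite ?qprod0 // qprodS IHn mulrC natrM add1n.
Qed.

Section CantorValue.
Variables (R : realType) (q E : nat -> nat).
Hypothesis q_ge2 : basic_sequence q.
Hypothesis E_lt : forall n, (0 < n)%N -> (E n < q n)%N.
Hypothesis E_lt_pred : forall m, exists2 n, (m < n)%N & ((E n).+1 < q n)%N.

Let partial_sum n : R := (numer q E n)%:R / (denom q n)%:R.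
Let upper_sum n : R := (numer q E n).+1%:R / (denom q n)%:R.

Definition cantor_value : R := sup (range partial_sum).

Definition tail n : R := (denom q n)%:R * cantor_value - (numer q E n)%:R.

Lemma tailS n : (q n.+1)%:R * tail n = (E n.+1)%:R + tail n.+1.
Proof. by rewrite /tail /= natrD !natrM; ring. Qed.

Lemma denom_gt0 n : (0 < denom q n)%N.
Proof.
by elim: n => //= n IHn; rewrite muln_gt0 IHn (ltn_trans _ (@q_ge2 n.+1 _)).
Qed.

Lemma partial_sum_homo : {homo partial_sum : m n / (m <= n)%N >-> m <= n}.
Proof.
apply/nondecreasing_seqP => n.
rewrite /partial_sum ler_pdivrMr ?ltr0n ?denom_gt0 // mulrAC.
rewrite ler_pdivlMr ?ltr0n ?denom_gt0 // -!natrM ler_nat /=.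
by rewrite mulnCA mulnA leq_mul2r leq_addr orbT.
Qed.

Lemma upper_sum_homo : {homo upper_sum : m n / (m <= n)%N >-> n <= m}.
Proof.
apply/nonincreasing_seqP => n.
rewrite /upper_sum ler_pdivrMr ?ltr0n ?denom_gt0 // mulrAC.
rewrite ler_pdivlMr ?ltr0n ?denom_gt0 // -!natrM ler_nat /=.
rewrite mulnCA mulnA leq_mul2r; apply/orP; right.
by rewrite -addnS mulnS addnC leq_add2r E_lt.
Qed.

Lemma partial_sum_le_upper_sum m n : partial_sum m <= upper_sum n.
Proof.
rewrite (@le_trans _ _ (partial_sum (maxn m n))) ?partial_sum_homo ?leq_maxl //.
rewrite (@le_trans _ _ (upper_sum (maxn m n))) ?upper_sum_homo ?leq_maxr //.
by rewrite ler_pM2r ?invr_gt0 ?ltr0n ?denom_gt0 // ler_nat.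
Qed.

Lemma tail_itv01 n : 0 <= tail n <= 1.
Proof.
have sum_ub : ubound (range partial_sum) (upper_sum n).
  by move=> _ [m _ <-]; exact: partial_sum_le_upper_sum.
have le_value : partial_sum n <= cantor_value.
  by apply: ub_le_sup; [exists (upper_sum n)|exists n].
have value_le : cantor_value <= upper_sum n.
  by apply: ge_sup => //; exists (partial_sum n), n.
move: le_value value_le; rewrite /partial_sum /upper_sum -natr1.
by rewrite ler_pdivrMr ?ler_pdivlMr ?ltr0n ?denom_gt0 // /tail; lra.
Qed.

Lemma tail_itv n : 0 <= tail n < 1.
Proof.
have /andP[-> _] /= := tail_itv01 n.
have tail_lt1 m : (E m.+1).+1%:R - 1 + tail m.+1 < (q m.+1)%:R -> tail m < 1.
  have q_gt0 : 0 < (q m.+1)%:R :> R.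
    by rewrite ltr0n (ltn_trans _ (@q_ge2 m.+1 _)).
  by rewrite -natr1 -(ltr_pM2l q_gt0 (tail m)) mulr1 tailS; lra.
have [m nm Em] := E_lt_pred n; case: m nm Em => // m; rewrite ltnS => nm Em.
have : tail m < 1.
  apply: tail_lt1; move: Em; rewrite -(ltr_nat R).
  by have := tail_itv01 m.+1; lra.
rewrite -(subnKC nm); elim: (m - n)%N => [|k IHk]; first by rewrite addn0.
rewrite addnS => tail_k; apply/IHk/tail_lt1.
by have := @E_lt (n + k).+1 isT; rewrite -(ler_nat R); lra.
Qed.

Lemma cantor_value_itv : 0 <= cantor_value < 1.
Proof. by have := tail_itv 0; rewrite /tail /= mul1r subr0. Qed.

Section Radix.
Variable b : nat.
Hypotheses (b_ge2 : (2 <= b)%N) (dvd_b : forall m, (0 < m)%N -> (b %| q m)%N).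

Lemma truncn_expM_cantor_value n :
  Num.truncn (b%:R ^+ n * cantor_value) =
  ((b ^ n * numer q E n) %/ denom q n)%N.
Proof.
have /dvdnP[c denomE] : (b ^ n %| denom q n)%N.
  by elim: n => //= n IHn; rewrite expnS dvdn_mul ?dvd_b.
have b_gt0 : (0 < b ^ n)%N by rewrite expn_gt0 (ltn_trans _ b_ge2).
have c_gt0 : (0 < c)%N.
  by have := denom_gt0 n; rewrite denomE muln_gt0 => /andP[].
rewrite [X in (_ %/ X)%N]denomE [(c * _)%N]mulnC divnMl //.
have : c%:R * (b%:R ^+ n * cantor_value) = (numer q E n)%:R + tail n.
  by rewrite /tail denomE natrM natrX; ring.
have /andP[tail_ge0 tail_lt1] := tail_itv n.
have := ltn_pmod (numer q E n) c_gt0.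
rewrite {2}(divn_eq (numer q E n) c) -(ler_nat R) natrD natrM -natr1.
set d := (_ %/ _)%N; set r := (_ %% _)%N => r_lt valueE.
apply: truncn_def; rewrite -(ler_pM2l (x := c%:R)) ?ltr0n //.
rewrite -(ltr_pM2l (x := c%:R)) ?ltr0n // valueE -natr1.
by have := ler0n R r; lra.
Qed.

Lemma cantor_digit_radix n : (0 < n)%N ->
  cantor_digit (fun=> b) cantor_value n = radix_digit b q E n.
Proof.
case: n => // n _; have b_basic : basic_sequence (fun=> b) by [].
have qprodE m : qprod R (fun=> b) 1 m = b%:R ^+ m by exact: qprod_const.
have expM_ge0 m : 0 <= b%:R ^+ m * cantor_value.
  by have /andP[x_ge0 _] := cantor_value_itv; rewrite mulr_ge0 ?exprn_ge0.
have := cantor_digit_fracp (fun=> b) cantor_value n.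
rewrite !qprodE !fracp_truncn // mulrBr mulrA -exprS /radix_digit.
rewrite -!truncn_expM_cantor_value.
have := cantor_digit_le b_basic cantor_value (ltn0Sn n).
move: (Num.truncn _) (Num.truncn _) => tS t.
set d := cantor_digit _ _ _ => d_le digitE.
suff -> : tS = (t * b + d)%N by rewrite modnMDl modn_small; lia.
by apply/eqP; rewrite -(eqr_nat R) natrD natrM; apply/eqP; lra.
Qed.

Lemma computable_cantor_value :
  total_recursive q -> total_recursive E -> computable_real cantor_value.
Proof.
move=> rq rE; exists b; split=> //.
exists (Num.floor cantor_value), (radix_digit b q E).
split; last exact: total_recursive_radix_digit.
by apply: eq_cantor_expansion cantor_digit_radix _; exact: cantor_expansionP.
Qed.
End Radix.
End CantorValue.

(** * Linear sequences modulo one *)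

Lemma natr_sum_ltn (R : pzSemiRingType) m n :
  \sum_(0 <= i < m) (i < n)%N%:R = (minn m n)%:R :> R.
Proof.
elim: m => [|m IHm]; first by rewrite big_geq // min0n.
rewrite big_nat_recr //= IHm -natrD; congr _%:R.
by rewrite /minn; case: (ltnP m n); case: (ltnP m.+1 n); lia.
Qed.

Lemma sum_nat_plateau (R : realDomainType) (phi : nat -> R) m w :
  (forall j, 0 <= phi j <= w) -> (forall j, (0 < j < m)%N -> phi j = w) ->
  (m%:R - 1) * w <= \sum_(0 <= j < m.+2) phi j <= (m%:R + 2) * w.
Proof.
move=> phi_itv phi_full; have w_ge0 : 0 <= w by have := phi_itv 0%N; lra.
apply/andP; split; last first.
  apply: le_trans (ler_sum_nat (G := fun=> w) _) _ => [j _|].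
    by have /andP[] := phi_itv j.
  by rewrite sumr_const_nat subn0 -[leLHS]mulr_natl -2!natr1; lra.
case: m => [|m] in phi_full *.
  apply: (@le_trans _ _ 0); first by lra.
  by rewrite sumr_ge0 // => j _; have /andP[] := phi_itv j.
rewrite big_ltn // 2?big_nat_recr //= (eq_big_nat _ _ phi_full).
rewrite sumr_const_nat subn1 /= -natr1 addrK mulr_natl.
by have := phi_itv 0%N; have := phi_itv m.+1; have := phi_itv m.+2; lra.
Qed.

Section Clamp.
Variable R : realType.
Implicit Types (V : nat) (u w : R).

Definition clamp V u : R := Num.max 0 (Num.min u V%:R).

Variant clamp_spec V u : R -> Prop :=
| ClampBelow of u <= 0 : clamp_spec V u 0
| ClampInside of 0 <= u & u <= V%:R : clamp_spec V u u
| ClampAbove of V%:R <= u : clamp_spec V u V%:R.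

Lemma clampP V u : clamp_spec V u (clamp V u).
Proof.
have V_ge0 : 0 <= V%:R :> R by [].
rewrite /clamp; have [u_le|/ltW u_ge] := leP u V%:R; last first.
  by rewrite max_r //; exact: ClampAbove.
by have [u_ge|/ltW u_le0] := leP 0 u; [exact: ClampInside|exact: ClampBelow].
Qed.

Lemma clamp_window V u w : 0 <= w -> 0 <= clamp V (u + w) - clamp V u <= w.
Proof.
by have V_ge0 : 0 <= V%:R :> R by []; case: (clampP V u); case: clampP; lra.
Qed.

Lemma clamp_inner_window V u w :
  0 <= w -> 0 <= u -> u + w <= V%:R -> clamp V (u + w) - clamp V u = w.
Proof. by case: (clampP V u); case: clampP; lra. Qed.

Lemma sum_clamp_windows (a : R) c V lo len (m := Num.truncn (a * V%:R)) :
  0 < a -> 0 <= c < 1 -> 0 <= lo -> 0 <= len -> lo + len <= 1 ->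
  `|\sum_(0 <= j < m.+2) (clamp V ((j%:R + lo - c) / a + len / a) -
                          clamp V ((j%:R + lo - c) / a)) - len * V%:R|
    <= 2 * (len / a).
Proof.
move=> a_gt0 /andP[c_ge0 c_lt1] lo_ge0 len_ge0 lolen.
have /truncn_itv /andP[] : 0 <= a * V%:R by rewrite mulr_ge0 // ltW.
rewrite -/m -natr1 => m_le m_gt; set w := len / a.
have w_ge0 : 0 <= w by rewrite divr_ge0 // ltW.
pose u j : R := (j%:R + lo - c) / a.
have phi_itv j : 0 <= clamp V (u j + w) - clamp V (u j) <= w.
  exact: clamp_window.
have phi_full j : (0 < j < m)%N -> clamp V (u j + w) - clamp V (u j) = w.
  case: j => // j /=; rewrite -(ltr_nat R) -natr1 => jm.
  have j_ge0 : 0 <= j%:R :> R by [].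
  apply: clamp_inner_window => //.
    by rewrite divr_ge0 ?(ltW a_gt0) // -natr1; lra.
  rewrite -mulrDl ler_pdivrMr // [V%:R * _]mulrC -natr1.
  have : j.+2%:R <= m%:R :> R by rewrite ler_nat -(ltr_nat R) -natr1.
  by rewrite -2!natr1; lra.
have /andP[le_sum sum_le] := sum_nat_plateau phi_itv phi_full.
have lenE : len * V%:R = a * V%:R * w by rewrite /w; field; exact: lt0r_neq0.
have le_pred : (a * V%:R - 2) * w <= (m%:R - 1) * w.
  by rewrite ler_wpM2r //; lra.
have le_succ : (m%:R + 2) * w <= (a * V%:R + 2) * w.
  by rewrite ler_wpM2r //; lra.
by rewrite ler_norml lenE; lra.
Qed.
End Clamp.

Section CountLinear.
Variables (R : realType) (t : nat -> R) (V : nat).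
Hypothesis t_itv : forall W, 0 <= t W <= 1.
Implicit Types (u w z a c lo hi len : R).

Lemma count_below u :
  `|\sum_(0 <= W < V) (W%:R + t W < u)%R%:R - clamp V u| <= 1.
Proof.
elim: V => [|n IHn].
  by rewrite big_geq //; case: (clampP 0 u) => *; rewrite ler_norml; lra.
have n_ge0 : 0 <= n%:R :> R by [].
have /andP[t_ge0 t_le1] := t_itv n.
rewrite big_nat_recr //=; have [u_le|u_gt] := lerP u n%:R.
  have clampS : clamp n.+1 u = clamp n u.
    by rewrite /clamp !min_l // (le_trans u_le) // ler_nat.
  have -> : (n%:R + t n < u) = false by apply/negbTE; rewrite -leNgt; lra.
  by rewrite clampS addr0.
rewrite (eq_big_nat _ _ (F2 := fun=> 1)) => [|W /andP[_ Wn]].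
  rewrite sumr_const_nat subn0; case: (_ < u); case: (clampP n.+1 u) => /=;
  by rewrite -?natr1 ler_norml; lra.
rewrite (_ : _ < u) //; have := t_itv W.
by move: Wn; rewrite -(ler_nat R) -natr1; lra.
Qed.

Lemma count_window u w : 0 <= w ->
  `|\sum_(0 <= W < V) (u <= W%:R + t W < u + w)%R%:R
    - (clamp V (u + w) - clamp V u)| <= 2.
Proof.
move=> w_ge0; have := (count_below u, count_below (u + w)).
set below_u := \sum_(_ <= _ < _) _; set below_uw := \sum_(_ <= _ < _) _ => -[].
suff -> : \sum_(0 <= W < V) (u <= W%:R + t W < u + w)%R%:R = below_uw - below_u.
  by rewrite !ler_norml; lra.
rewrite -sumrB; apply: eq_bigr => W _; move: (W%:R + t W) => z.
case: (lerP u z) => zu; case: (ltrP z (u + w)) => zuw;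
by rewrite /= ?subr0 ?subrr //; lra.
Qed.

Lemma sum_fracp_window z J lo hi : 0 <= lo -> hi <= 1 -> 0 <= z < J%:R ->
  \sum_(0 <= j < J) (j%:R + lo <= z < j%:R + hi)%R%:R =
  (lo <= fracp z < hi)%R%:R :> R.
Proof.
move=> lo_ge0 hi_le1 /andP[z_ge0 zJ]; have /truncn_itv /andP[] := z_ge0.
rewrite fracp_truncn //; set f := Num.truncn z; rewrite -natr1 => f_le f_gt.
rewrite (eq_bigr (fun j => if j == f then (lo <= z - f%:R < hi)%R%:R else 0)).
  by rewrite -big_mkcond big_nat1_eq /= truncn_lt_nat // zJ.
move=> j _; have [->|] := eqVneq j f; first by rewrite lerBrDl ltrBlDl.
rewrite neq_ltn => /orP[]; rewrite -(ler_nat R) -natr1 => jf.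
  by rewrite [_ < j%:R + hi]ltNge (_ : j%:R + hi <= z) ?andbF //; lra.
by rewrite leNgt (_ : z < j%:R + lo) //; lra.
Qed.

Lemma count_fracp_linear_pos a c lo len :
  0 < a -> 0 <= c < 1 -> 0 <= lo -> 0 <= len -> lo + len <= 1 ->
  `|\sum_(0 <= W < V) (lo <= fracp (c + a * (W%:R + t W)) < lo + len)%R%:R
    - len * V%:R| <= 2 * (len / a) + 2 * (a * V%:R) + 4.
Proof.
move=> a_gt0 c_itv lo_ge0 len_ge0 lolen; have /andP[c_ge0 c_lt1] := c_itv.
have aV_ge0 : 0 <= a * V%:R by rewrite mulr_ge0 // ltW.
have := sum_clamp_windows V a_gt0 c_itv lo_ge0 len_ge0 lolen.
have /truncn_itv /andP[] := aV_ge0; set m := Num.truncn _.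
rewrite -natr1 => m_le m_gt.
set u := fun j : nat => (j%:R + lo - c) / a; rewrite -/(u _).
have -> : \sum_(0 <= W < V)
      (lo <= fracp (c + a * (W%:R + t W)) < lo + len)%R%:R =
    \sum_(0 <= j < m.+2) \sum_(0 <= W < V)
      (u j <= W%:R + t W < u j + len / a)%R%:R :> R.
  rewrite exchange_big /=; apply: eq_big_nat => W /andP[_ WV].
  have /andP[t_ge0 t_le1] := t_itv W.
  rewrite -(@sum_fracp_window _ m.+2) ?lolen //; last first.
    have le_aV : a * (W%:R + t W) <= a * V%:R.
      by rewrite ler_pM2l //; move: WV; rewrite -(ler_nat R) -natr1; lra.
    have ge0_aW : 0 <= a * (W%:R + t W) by rewrite mulr_ge0 ?addr_ge0 // ltW.
    by rewrite -2!natr1; lra.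
  apply: eq_bigr => j _; rewrite /u -mulrDl ler_pdivrMr // ltr_pdivlMr //.
  by congr (nat_of_bool (_ && _))%:R; apply/idP/idP; lra.
set count_sum := \sum_(_ <= _ < _) _; set clamp_sum := \sum_(_ <= _ < _) _.
suff : `|count_sum - clamp_sum| <= 2 * (m%:R + 2) by rewrite !ler_norml; lra.
rewrite -sumrB; apply: le_trans (ler_norm_sum _ _ _) _.
apply: le_trans (ler_sum_nat (G := fun=> 2) _) _ => [j _|].
  by apply: count_window; rewrite divr_ge0 // ltW.
by rewrite sumr_const_nat subn0 -[leLHS]mulr_natr -2!natr1; lra.
Qed.
End CountLinear.

(** For [a < 0], reversing the sample points by [W |-> V-1-W] changes the sign
    of the slope at the cost of an offset. *)
Lemma count_fracp_linear (R : realType) (t : nat -> R) V (a lo len : R) :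
  (forall W, 0 <= t W <= 1) -> a != 0 -> 0 <= lo -> 0 <= len -> lo + len <= 1 ->
  `|\sum_(0 <= W < V) (lo <= fracp (a * (W%:R + t W)) < lo + len)%R%:R
    - len * V%:R| <= 2 * (len / `|a|) + 2 * (`|a| * V%:R) + 4.
Proof.
move=> t_itv a_neq0 lo_ge0 len_ge0 lolen.
have [a_gt0|a_lt0|a_eq0] := ltrgtP 0 a.
- have zero_itv : 0 <= (0 : R) < 1 by rewrite lexx ltr01.
  have := count_fracp_linear_pos V t_itv a_gt0 zero_itv lo_ge0 len_ge0 lolen.
  by rewrite (gtr0_norm a_gt0); under eq_bigr do rewrite add0r.
- pose t' W := 1 - t (V - W.+1)%N.
  have t'_itv W : 0 <= t' W <= 1.
    by have := t_itv (V - W.+1)%N; rewrite /t'; lra.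
  have aN_gt0 : 0 < - a by rewrite oppr_gt0.
  have := count_fracp_linear_pos V t'_itv aN_gt0 (fracp_itv (a * V%:R))
    lo_ge0 len_ge0 lolen.
  rewrite (ltr0_norm a_lt0) big_nat_rev /=; congr (`|_ - _| <= _).
  apply: eq_big_nat => W /andP[_ WV]; rewrite add0n addrC fracpD_fracp.
  have revK : (V - (V - W.+1).+1)%N = W by lia.
  suff -> : - a * ((V - W.+1)%:R + t' (V - W.+1)%N) + a * V%:R =
    a * (W%:R + t W) by [].
  by rewrite /t' revK natrB // -natr1; ring.
- by rewrite -a_eq0 eqxx in a_neq0.
Qed.

(** * Asymptotic equivalence of sequences *)

Section Equivalence.
Variable R : realType.
Implicit Types (f g h s A S : R ^nat).

Lemma equivP f g : f ~_\oo g <->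
  forall e, 0 < e -> \forall n \near \oo, `|f n - g n| <= e * `|g n|.
Proof. exact: eqaddoP. Qed.

Lemma equiv_comp (idx : nat -> nat) f g :
  idx @ \oo --> \oo -> f ~_\oo g -> f \o idx ~_\oo g \o idx.
Proof. by move=> idx_oo /equivP fg; apply/equivP => e /fg; exact: idx_oo. Qed.

Lemma equiv_cvg_ratio f g :
  (\forall n \near \oo, g n != 0) -> f ~_\oo g ->
  (fun n => f n / g n) @ \oo --> (1 : R).
Proof.
move=> g_neq0 /equivP fg; apply/cvgrPdistC_le => e e_gt0; near=> n.
have gn_neq0 : g n != 0 by near: n.
rewrite (_ : f n / g n - 1 = (f n - g n) / g n); last by field.
rewrite normrM normfV ler_pdivrMr ?normr_gt0 //; near: n; exact: fg.
Unshelve. all: by end_near. Qed.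

Lemma equiv_squeeze f g h s :
  (\forall n \near \oo, f n <= g n <= h n) ->
  f ~_\oo s -> h ~_\oo s -> g ~_\oo s.
Proof.
move=> fgh /equivP fs /equivP hs; apply/equivP => e e_gt0; near=> n.
have : f n <= g n <= h n by near: n.
have : `|f n - s n| <= e * `|s n| by near: n; exact: fs.
have : `|h n - s n| <= e * `|s n| by near: n; exact: hs.
by rewrite !ler_norml; lra.
Unshelve. all: by end_near. Qed.

Theorem stolz_cesaro A S :
  nondecreasing_seq S -> S @ \oo --> +oo ->
  telescope A ~_\oo telescope S -> A ~_\oo S.
Proof.
move=> S_homo S_oo /equivP AS; apply/equivP => e e_gt0.
have [|N _ increment_le] := AS (e / 2); first by lra.
pose initial_error := `|A N - S N|.
have error_le k :
    `|A (N + k)%N - S (N + k)%N| <= initial_error + e / 2 * (S (N + k)%N - S N).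
  elim: k => [|k IHk]; first by rewrite addn0 subrr mulr0 addr0.
  have := increment_le (N + k)%N (leq_addr _ _); rewrite /telescope /= addnS.
  have S_le : S (N + k)%N <= S (N + k).+1 by exact: S_homo.
  rewrite (ger0_norm (x := S _ - S _)) ?subr_ge0 //.
  by move: IHk; rewrite !ler_norml; lra.
near=> n; have Nn : (N <= n)%N by near: n; exact: nbhs_infty_ge.
have := error_le (n - N)%N; rewrite subnKC // => /le_trans; apply.
have S_ge : (initial_error - e / 2 * S N) / (e / 2) <= S n.
  by near: n; move/cvgryPge: S_oo; exact.
have S_ge0 : 0 <= S n by near: n; move/cvgryPge: S_oo; exact.
move: S_ge; rewrite ler_pdivrMr; last by lra.
by rewrite ger0_norm //; lra.
Unshelve. all: by end_near. Qed.

End Equivalence.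

Section StagewiseSums.
Variables (R : realType) (p idx : nat -> nat) (b : R ^nat).
Hypothesis p_homo : {homo p : m n / (m <= n)%N}.
Hypothesis idx_itv : forall n, (p (idx n) <= n < p (idx n).+1)%N.
Hypothesis idx_oo : idx @ \oo --> \oo.
Hypothesis b_ge0 : forall i, 0 <= b i.
Hypothesis series_b_oo : series b @ \oo --> +oo.
Hypothesis b_small : b =o_\oo series b.

Lemma equiv_series_succ : series b \o succn ~_\oo series b.
Proof.
apply/equivP => e e_gt0; move/eqoP: b_small => /(_ _ e_gt0).
apply: filterS => n.
by rewrite /= /series /= big_nat_recr //= addrAC subrr add0r.
Qed.

Lemma equiv_sum_stages (f : R ^nat) m : (forall j, 0 <= f j) ->
  (fun i => \sum_(p i <= j < p i.+1) f j) ~_\oo b ->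
  (fun n => \sum_(m <= j < n) f j) ~_\oo series b \o idx.
Proof.
move=> f_ge0 /equivP stage_b; pose A n := \sum_(m <= j < n) f j.
have p_ge : \forall i \near \oo, (m <= p i)%N.
  exists (idx m).+1 => // i /p_homo; apply: leq_trans.
  by have /andP[_ /ltnW] := idx_itv m.
have Ap_b : A \o p ~_\oo series b.
  apply: stolz_cesaro => //; first exact: nondecreasing_series.
  rewrite seriesK; apply/equivP => e e_gt0; near=> i.
  suff -> : telescope (A \o p) i = \sum_(p i <= j < p i.+1) f j.
    by near: i; exact: stage_b.
  rewrite /telescope /= /A (big_cat_nat (n := p i)) ?p_homo //=.
    by rewrite [X in X - _]addrC addrK.
  by near: i.
have succ_oo : succn @ \oo --> \oo.
  by apply/cvgnyPge => N; exists N => // i /leqW.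
apply: (@equiv_squeeze _ (A \o p \o idx) _ (A \o p \o succn \o idx)).
- apply: nearW => n; have /andP[/= le_n n_lt] := idx_itv n.
  have A_homo : nondecreasing_seq A by exact: nondecreasing_series.
  by rewrite !A_homo // ltnW.
- exact: equiv_comp Ap_b.
- apply: (@equiv_comp _ idx (A \o p \o succn)) => //.
  exact: equiv_trans (equiv_comp succ_oo Ap_b) equiv_series_succ.
Unshelve. all: by end_near. Qed.

Lemma cvg_ratio_sum_stages (f g : R ^nat) m :
  (forall j, 0 <= f j) -> (forall j, 0 < g j) ->
  (fun i => \sum_(p i <= j < p i.+1) f j) ~_\oo b ->
  (fun i => \sum_(p i <= j < p i.+1) g j) ~_\oo b ->
  (fun n : nat => (\sum_(m <= j < n.+1) f j) / \sum_(m <= j < n.+1) g j)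
    @ \oo --> (1 : R).
Proof.
move=> f_ge0 g_gt0 /(equiv_sum_stages m f_ge0) f_b.
move=> /(equiv_sum_stages m (fun j => ltW (g_gt0 j))) /equiv_sym b_g.
rewrite (cvg_shiftS (fun n => (\sum_(m <= j < n) f j) / \sum_(m <= j < n) g j)).
apply: equiv_cvg_ratio (equiv_trans f_b b_g).
exists m.+1 => // n; case: n => // n; rewrite /= ltnS => le_mn.
rewrite big_nat_recr //= gt_eqF // ltr_wpDl ?sumr_ge0 // => j _.
exact: ltW.
Qed.
End StagewiseSums.

(** * Sums over segments and periods *)

Section SumRearrangement.
Variable R : nmodType.
Implicit Type F : nat -> R.

Lemma sum_nat_shift F m n :
  \sum_(m <= j < m + n) F j = \sum_(0 <= i < n) F (m + i)%N.
Proof.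
rewrite -{1}[m]add0n big_addn addKn.
by apply: eq_bigr => i _; rewrite addnC.
Qed.

Lemma sum_squares F a b : (a <= b)%N ->
  \sum_(a ^ 2 <= j < b ^ 2) F j =
  \sum_(a <= s < b) \sum_(0 <= o < s.*2.+1) F (s ^ 2 + o)%N.
Proof.
elim: b => [|b IHb]; first by case: a => // _; rewrite !big_geq.
rewrite leq_eqVlt => /predU1P[->|]; first by rewrite !big_geq.
rewrite ltnS => le_ab; rewrite [RHS]big_nat_recr //= -IHb //.
rewrite (big_cat_nat (n := (b ^ 2)%N)) ?leq_sqr //=.
congr (_ + _); rewrite (_ : b.+1 ^ 2 = b ^ 2 + b.*2.+1)%N; last by lia.
exact: sum_nat_shift.
Qed.

Lemma sum_fourth_powers F i :
  \sum_(i ^ 4 <= j < i.+1 ^ 4) F j =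
  \sum_(0 <= t < i.*2.+1) \sum_(0 <= o < (i ^ 2 + t).*2.+1)
     F ((i ^ 2 + t) ^ 2 + o)%N.
Proof.
rewrite (expnM i 2 2) (expnM i.+1 2 2) sum_squares ?leq_sqr //.
rewrite (_ : i.+1 ^ 2 = i ^ 2 + i.*2.+1)%N; last by lia.
exact: sum_nat_shift.
Qed.
End SumRearrangement.

Section SumEstimates.
Variable R : realType.

Section AlmostPeriodic.
Variables (f : nat -> R) (V : nat) (D err : R).
Hypotheses (V_gt0 : (0 < V)%N) (f_ge0 : forall t, 0 <= f t).
Hypothesis period_sum :
  forall u, `|\sum_(0 <= W < V) f (u * V + W)%N - D| <= err.

Lemma sum_full_periods u :
  `|\sum_(0 <= t < u * V) f t - u%:R * D| <= u%:R * err.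
Proof.
elim: u => [|u IHu]; first by rewrite mul0n big_geq // !mul0r subrr normr0.
rewrite mulSnr (big_cat_nat (n := (u * V)%N)) ?leq_addr //=.
rewrite (sum_nat_shift _ (u * V)).
by move: IHu (period_sum u); rewrite -natr1 !ler_norml; lra.
Qed.

Lemma sum_almost_periodic K : 0 <= D -> 0 <= err ->
  `|\sum_(0 <= t < K) f t - K%:R / V%:R * D| <= K%:R / V%:R * err + D + err.
Proof.
move=> D_ge0 err_ge0; have := divn_eq K V; have := ltn_pmod K V_gt0.
move: (K %/ V)%N (K %% V)%N => u r rV ->.
rewrite (big_cat_nat (n := (u * V)%N)) ?leq_addr //= (sum_nat_shift _ (u * V)).
have rest_itv : 0 <= \sum_(0 <= W < r) f (u * V + W)%N <= D + err.
  rewrite sumr_ge0 //=.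
  apply: (@le_trans _ _ (\sum_(0 <= W < V) f (u * V + W)%N)).
    by rewrite [leRHS](big_cat_nat (n := r)) ?(ltnW rV) //= lerDl sumr_ge0.
  by have := period_sum u; rewrite ler_norml; lra.
rewrite natrD natrM mulrDl mulfK ?pnatr_eq0 -?lt0n //.
have frac_itv : 0 <= (r%:R / V%:R : R) <= 1.
  by rewrite divr_ge0 //= ler_pdivrMr ?ltr0n // mul1r ler_nat ltnW.
have fracM_itv (z : R) : 0 <= z -> 0 <= r%:R / V%:R * z <= z.
  by case/andP: frac_itv => ? ? z_ge0; rewrite ler_piMl // mulr_ge0.
have := fracM_itv D D_ge0; have := fracM_itv err err_ge0.
by move: (sum_full_periods u) rest_itv; rewrite !ler_norml; lra.
Qed.
End AlmostPeriodic.

Lemma sum_geometric_le (b : R) L :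
  2 <= b -> \sum_(0 <= e < L.+1) b ^+ e <= 2 * b ^+ L.
Proof.
move=> b_ge2; elim: L => [|L IHL]; first by rewrite big_nat1 expr0; lra.
rewrite big_nat_recr //= exprS.
have : 2 * b ^+ L <= b * b ^+ L by rewrite ler_wpM2r // exprn_ge0; lra.
lra.
Qed.
End SumEstimates.

(** * The basic sequence and the digits *)

Section Construction.
Local Open Scope nat_scope.

Definition sqrtn : nat -> nat := lower_inverse (fun n => n ^ 2).

Definition radix g := g.*2.+2.

(** With this choice, the [2 i + 1] segments of stage [i] run at least [level i]
    times through the words of length [level i]. *)
Definition level : nat -> nat := lower_inverse (fun g => g * radix g ^ g).

(** Position [n = s^2 + o], [o <= 2s], has offset [o] in segment [s]; segment
    [s = i^2 + t], [t <= 2i], belongs to stage [i].  Each segment is a word of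
    length [level i] followed by fillers, and the word is [t] modulo the number
    of words, written in base [radix (level i)]. *)
Definition segment := sqrtn.
Definition offset n := n - segment n ^ 2.
Definition stage n := sqrtn (segment n).
Definition word_length n := level (stage n).
Definition filler n := word_length n <= offset n.
Definition word_radix n := radix (word_length n).
Definition word_index n :=
  (segment n - stage n ^ 2) %% word_radix n ^ word_length n.

Definition bases n := if filler n then n.+1`! else word_radix n.
Definition digits n :=
  if filler n then n`!
  else word_index n %/ word_radix n ^ (word_length n - (offset n).+1)
    %% word_radix n.

Lemma recursive_sqrtn k (F : k.-tuple nat -> nat) :
  recursive F -> recursive (fun v => sqrtn (F v)).
Proof.
apply/recursive_app/total_recursive_lower_inverse/total_recursiveP.
exact: recursive_exp (recursive_proj _) (recursive_const _ 2).
Qed.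

Lemma recursive_radix k (F : k.-tuple nat -> nat) :
  recursive F -> recursive (fun v => radix (F v)).
Proof.
move=> rF; apply: (@eq_recursive _ (fun v => (F v + F v).+2)).
  by move=> v; rewrite addnn.
exact: recursive_succ (recursive_succ (recursive_add rF rF)).
Qed.

Lemma recursive_level k (F : k.-tuple nat -> nat) :
  recursive F -> recursive (fun v => level (F v)).
Proof.
apply/recursive_app/total_recursive_lower_inverse/total_recursiveP.
have r_id := recursive_proj (@ord0 0).
exact: recursive_mul r_id (recursive_exp (recursive_radix r_id) r_id).
Qed.

Section RecursiveDigits.
Let r_id := recursive_proj (@ord0 0).
Let r_segment := recursive_sqrtn r_id.
Let r_stage := recursive_sqrtn r_segment.
Let r_length := recursive_level r_stage.
Let r_radix := recursive_radix r_length.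
Let r_offset :=
  recursive_sub r_id (recursive_exp r_segment (recursive_const _ 2)).
Let r_filler := recursive_leq r_length r_offset.

Lemma total_recursive_bases : total_recursive bases.
Proof.
apply/total_recursiveP.
exact: recursive_if r_filler (recursive_fact (recursive_succ r_id)) r_radix.
Qed.

Lemma total_recursive_digits : total_recursive digits.
Proof.
have r_index :=
  recursive_sub r_segment (recursive_exp r_stage (recursive_const _ 2)).
have r_word := recursive_mod r_index (recursive_exp r_radix r_length).
have r_power :=
  recursive_exp r_radix (recursive_sub r_length (recursive_succ r_offset)).
apply/total_recursiveP; apply: (recursive_if r_filler (recursive_fact r_id)).
exact: recursive_mod (recursive_div r_word r_power) r_radix.
Qed.
End RecursiveDigits.

Lemma sqrtn_itv n : sqrtn n ^ 2 <= n < (sqrtn n).+1 ^ 2.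
Proof.
by apply: (lower_inverse_itv (h := fun n => n ^ 2)) => // m; rewrite ltn_sqr.
Qed.

Lemma leq_sqrtn m n : (m <= sqrtn n) = (m ^ 2 <= n).
Proof.
by apply: (leq_lower_inverse (h := fun n => n ^ 2)) => // k; rewrite ltn_sqr.
Qed.

Lemma sqrtn_def m n : m ^ 2 <= n < m.+1 ^ 2 -> sqrtn n = m.
Proof.
move=> /andP[le_n n_lt]; apply/eqP; rewrite eqn_leq -ltnS ltnNge !leq_sqrtn.
by rewrite le_n andbT -ltnNge.
Qed.

Lemma level_threshold_lt g : g * radix g ^ g < g.+1 * radix g.+1 ^ g.+1.
Proof.
apply: (@leq_trans (g.+1 * radix g ^ g)); first by rewrite ltn_pmul2r ?expn_gt0.
rewrite leq_pmul2l //.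
apply: (@leq_trans (radix g.+1 ^ g)); last by rewrite leq_pexp2l.
by case: g => // g; rewrite leq_exp2r // /radix; lia.
Qed.

Lemma leq_level m n : (m <= level n) = (m * radix m ^ m <= n).
Proof.
exact: (leq_lower_inverse (h := fun g => g * radix g ^ g) _ level_threshold_lt).
Qed.

Lemma level_bound i : level i * radix (level i) ^ level i <= i.
Proof. by rewrite -leq_level. Qed.

Lemma level_homo : {homo level : m n / m <= n}.
Proof.
move=> m n; apply: (leq_lower_inverse2 (h := fun g => g * radix g ^ g)) => //.
exact: level_threshold_lt.
Qed.

Lemma level_le i : level i <= i.
Proof. by apply: leq_trans (level_bound i); rewrite leq_pmulr ?expn_gt0. Qed.

Lemma sqrtn_le n : sqrtn n <= n.
Proof. by have := sqrtn_itv n; case: (sqrtn n) => // m; nia. Qed.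

Section Segment.
Variables s o : nat.
Hypothesis o_le : o <= s.*2.

Lemma sqrtn_sqrD : sqrtn (s ^ 2 + o) = s.
Proof. by apply: sqrtn_def; lia. Qed.

Lemma offset_sqrD : offset (s ^ 2 + o) = o.
Proof. by rewrite /offset /segment sqrtn_sqrD addKn. Qed.

Lemma word_length_sqrD : word_length (s ^ 2 + o) = level (sqrtn s).
Proof. by rewrite /word_length /stage /segment sqrtn_sqrD. Qed.

Lemma filler_sqrD : filler (s ^ 2 + o) = (level (sqrtn s) <= o).
Proof. by rewrite /filler offset_sqrD word_length_sqrD. Qed.
End Segment.

Lemma level_sqrtn_le s : level (sqrtn s) <= s.
Proof. exact: leq_trans (level_le _) (sqrtn_le _). Qed.

Lemma filler_pred_sqr s : 0 < s -> filler (s ^ 2).-1.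
Proof.
case: s => // s _; rewrite (_ : (s.+1 ^ 2).-1 = s ^ 2 + s.*2); last by lia.
by rewrite filler_sqrD // (leq_trans (level_sqrtn_le s)) //; lia.
Qed.

Lemma bases_filler n : filler n -> bases n = n.+1`!.
Proof. by rewrite /bases => ->. Qed.

Lemma digits_filler n : filler n -> digits n = n`!.
Proof. by rewrite /digits => ->. Qed.

Lemma basic_bases : basic_sequence bases.
Proof.
case=> // n _; rewrite /bases; case: ifP => // _.
by apply: (@leq_trans n.+2); rewrite ?fact_geq.
Qed.

Lemma bases_gt0 n : 0 < bases n.
Proof. by rewrite /bases; case: ifP => // _; exact: fact_gt0. Qed.

Lemma dvdn2_bases n : 0 < n -> 2 %| bases n.
Proof.
case: n => // n _; rewrite /bases; case: ifP => _; first by rewrite dvdn_fact.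
by rewrite dvdn2 /word_radix /radix; lia.
Qed.

Lemma digits_lt n : 0 < n -> digits n < bases n.
Proof.
case: n => // n _; rewrite /digits /bases.
case: ifP => _; last by rewrite ltn_mod.
by rewrite [X in _ < X]factS -[X in X < _]mul1n ltn_pmul2r ?fact_gt0.
Qed.

Lemma digits_lt_pred m : exists2 n, m < n & (digits n).+1 < bases n.
Proof.
exists (m.+2 ^ 2).-1; first by lia.
have n_filler := filler_pred_sqr (ltn0Sn m.+1).
rewrite bases_filler // digits_filler // factS.
by move: (fact_gt0 (m.+2 ^ 2).-1); move: (_`!) => a; nia.
Qed.

Section Word.
Variable s : nat.
Hypothesis s_gt0 : 0 < s.
Let g := level (sqrtn s).
Let b := radix g.
Let W := (s - sqrtn s ^ 2) %% b ^ g.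
Let p := (s ^ 2).-1.

Lemma bases_word o : o < g -> bases (s ^ 2 + o) = b.
Proof.
have := level_sqrtn_le s; rewrite -/g => g_le o_lt.
have o_le : o <= s.*2 by lia.
by rewrite /bases filler_sqrD // leqNgt -/g o_lt /word_radix word_length_sqrD.
Qed.

Lemma digits_word o : o < g -> digits (s ^ 2 + o) = W %/ b ^ (g - o.+1) %% b.
Proof.
have := level_sqrtn_le s; rewrite -/g => g_le o_lt.
have o_le : o <= s.*2 by lia.
rewrite /digits filler_sqrD // leqNgt -/g o_lt.
rewrite /word_index /word_radix word_length_sqrD //.
by rewrite offset_sqrD // /stage /segment sqrtn_sqrD.
Qed.

Lemma pred_sqrD o : (p + o).+1 = s ^ 2 + o.
Proof. by rewrite /p -addSn prednK // expn_gt0 s_gt0. Qed.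

Lemma denom_word o : o <= g -> denom bases (p + o) = b ^ o * denom bases p.
Proof.
elim: o => [|o IHo] o_le; first by rewrite addn0 mul1n.
by rewrite addnS /= pred_sqrD bases_word // IHo 1?ltnW // expnS mulnA.
Qed.

Lemma numer_word o : o <= g ->
  numer bases digits (p + o) = b ^ o * numer bases digits p + W %/ b ^ (g - o).
Proof.
elim: o => [|o IHo] o_le.
  by rewrite addn0 mul1n subn0 divn_small ?addn0 // ltn_mod expn_gt0.
rewrite addnS /= pred_sqrD bases_word // digits_word // IHo 1?ltnW //.
rewrite mulnDr mulnA -expnS -addnA; congr (_ + _).
by rewrite [RHS](divn_eq _ b) -divnMA -expnSr -subSn // subSS [b * _]mulnC.
Qed.
End Word.
End Construction.

(** * Affine images of the number *)

Section Affine.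
Variable R : realType.
Local Notation x := (cantor_value R bases digits).
Local Notation tailx := (tail R bases digits).
Local Notation P n := (qprod R bases 1 n).

Lemma tailx_itv n : 0 <= tailx n < 1.
Proof. exact: (tail_itv R basic_bases digits_lt digits_lt_pred). Qed.

Lemma filler_tail_itv n :
  filler n.+1 -> n.+2%:R^-1 <= tailx n <= 2 / n.+2%:R.
Proof.
move=> n_filler; have := tailS R bases digits n.
rewrite bases_filler // digits_filler // factS natrM -mulrA.
have /andP[tail_ge0 tail_lt1] := tailx_itv n.+1.
have fact_ge1 : 1 <= n.+1`!%:R :> R by rewrite ler1n fact_gt0.
have fact_gt0R := lt_le_trans ltr01 fact_ge1.
have n_gt0 : 0 < n.+2%:R :> R by [].
rewrite ler_pdivlMr // -[_^-1]div1r ler_pdivrMr // [tailx n * _]mulrC mulrCA.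
by rewrite -(ler_pM2l fact_gt0R 1) -(ler_pM2l fact_gt0R _ 2) => ->; lra.
Qed.

Lemma fracp_word (y rho : R) s e (p := (s ^ 2).-1) (g := level (sqrtn s)) :
  (0 < s)%N -> (e <= g)%N -> fracp (P p * y) = fracp (rho * tailx p) ->
  fracp (P (p + e) * y) =
  fracp (rho * (radix g)%:R ^+ e / (radix g ^ g)%:R *
    (((s - sqrtn s ^ 2) %% radix g ^ g)%:R + tailx (p + g))).
Proof.
move=> s_gt0 e_le fracp_p.
have tail_p : (radix g ^ g)%:R * tailx p =
    ((s - sqrtn s ^ 2) %% radix g ^ g)%:R + tailx (p + g).
  rewrite /tail denom_word // numer_word // subnn expn0 divn1.
  by rewrite natrD !natrM; ring.
rewrite -tail_p qprod_denom denom_word // natrM -mulrA -fracpM_nat -qprod_denom.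
rewrite fracp_p fracpM_nat natrX; congr fracp; field.
by rewrite pnatr_eq0 expn_eq0.
Qed.

Variables (d : nat) (a c : int) (rho sigma : R).
Hypotheses (d_gt0 : (0 < d)%N) (rho_neq0 : rho != 0).
Hypotheses (rhoE : rho = a%:~R / d%:R) (sigmaE : sigma = c%:~R / d%:R).
Let y := rho * x + sigma.
Let affine_numer n := a * (numer bases digits n)%:Z + c * (denom bases n)%:Z.

Lemma qprod_affine n : P n * y = (affine_numer n)%:~R / d%:R + rho * tailx n.
Proof.
have d_neq0 : d%:R != 0 :> R by rewrite pnatr_eq0 -lt0n.
rewrite qprod_denom /y /tail rhoE sigmaE intrD !intrM -!pmulrn; field.
exact: d_neq0.
Qed.

Lemma filler_fracp_affine :
  \forall n \near \oo, filler n -> fracp (P n * y) = fracp (rho * tailx n).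
Proof.
exists d => // -[|n] /= d_le n_filler; first by rewrite leqNgt d_gt0 in d_le.
have d_digit : (d %| n.+1`!)%N by rewrite dvdn_fact // d_gt0.
have d_base : (d %| n.+2`!)%N by rewrite dvdn_fact // d_gt0 ltnW.
have /dvdnP[u numerE] : (d %| numer bases digits n.+1)%N.
  by rewrite /= bases_filler // digits_filler // dvdn_addr // dvdn_mulr.
have /dvdnP[v denomE] : (d %| denom bases n.+1)%N.
  by rewrite /= bases_filler // dvdn_mulr.
rewrite qprod_affine /affine_numer numerE denomE addrC.
rewrite -[RHS](fracpDz _ (a * u%:Z + c * v%:Z)).
congr (fracp (_ + _)); rewrite !intrD !intrM -!pmulrn !natrM; field.
by rewrite pnatr_eq0 -lt0n.
Qed.

(** At a filler position [n], [q_n tail_(n-1)] is of the order of [n!], and the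
    denominator [d] prevents [fracp (P_(n-1) y)] from being smaller than
    [|rho| tail_(n-1)], so the digit of [y] is of the order of [n!] at least. *)
Lemma filler_digit_affine K :
  \forall n \near \oo, filler n -> (K < cantor_digit bases y n)%N.
Proof.
have rho_gt0 : 0 < `|rho| by rewrite normr_gt0.
have d_gt0R : 0 < d%:R :> R by rewrite ltr0n.
apply: near_inftyS; near=> n => n_filler.
have n_gt0 : 0 < n.+2%:R :> R by [].
have /andP[tail_ge tail_le] := filler_tail_itv n_filler.
have tail_gt0 : 0 < tailx n by rewrite (lt_le_trans _ tail_ge) ?invr_gt0.
have rho_tailE : `|rho * tailx n| = `|rho| * tailx n.
  by rewrite normrM (gtr0_norm tail_gt0).
have fracp_ge : `|rho| / n.+2%:R <= fracp (P n * y).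
  apply: (@le_trans _ _ `|rho * tailx n|); first by rewrite rho_tailE ler_pM2l.
  rewrite qprod_affine fracp_rat_add_ge // rho_tailE.
  have n_ge : `|rho| * 4 * d%:R <= n%:R by near: n; exact: nbhs_infty_ger.
  apply: (@le_trans _ _ (`|rho| * (2 / n.+2%:R) * 2)).
    by rewrite ler_pM2r // ler_pM2l.
  rewrite (_ : _ * 2 = `|rho| * 4 / n.+2%:R); last by ring.
  rewrite ler_pdivrMr // ler_pdivlMl // mulrC (le_trans n_ge) // ler_nat.
  by rewrite (leq_trans (leqnSn n)).
have digitE : (bases n.+1)%:R * fracp (P n * y) =
    (cantor_digit bases y n.+1)%:R + fracp (P n.+1 * y).
  exact: cantor_digit_fracp.
have base_fracp_ge : n.+1%:R * `|rho| <= (bases n.+1)%:R * fracp (P n * y).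
  apply: le_trans (ler_wpM2l _ fracp_ge) => //.
  rewrite bases_filler // factS natrM [n.+2%:R * _]mulrC mulrACA.
  by rewrite divff ?lt0r_neq0 // mulr1 ler_pM2r // ler_nat fact_geq.
have n_ge : K.+2%:R / `|rho| <= n%:R by near: n; exact: nbhs_infty_ger.
have /andP[_ fracp_lt1] := fracp_itv (P n.+1 * y).
rewrite -(ltr_nat R); move: n_ge; rewrite ler_pdivrMr //.
by move: base_fracp_ge; rewrite digitE -!natr1; lra.
Unshelve. all: by end_near. Qed.
End Affine.

(** * Frequencies of blocks *)

Lemma level_cvg : level @ \oo --> \oo.
Proof.
apply/cvgnyPge => g; exists (g * radix g ^ g)%N => // i /=.
by rewrite leq_level.
Qed.

Lemma stage_cvg : stage @ \oo --> \oo.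
Proof.
apply/cvgnyPge => i; exists (i ^ 4)%N => // n /=.
by rewrite /stage /segment !leq_sqrtn -expnM.
Qed.

Lemma stage_itv n : (stage n ^ 4 <= n < (stage n).+1 ^ 4)%N.
Proof.
have /andP[le_n n_lt] := sqrtn_itv n.
have /andP[le_s s_lt] := sqrtn_itv (sqrtn n).
rewrite /stage /segment !(expnM _ 2 2) (leq_trans _ le_n) ?leq_sqr //=.
by rewrite (leq_trans n_lt) // leq_sqr.
Qed.

Lemma near_stage (P : nat -> Prop) :
  (\forall n \near \oo, P n) ->
  \forall i \near \oo, forall t n,
    (((i ^ 2 + t) ^ 2).-1 <= n)%N -> P n.
Proof.
move=> [N _ NP]; exists N.+1 => // i /= Ni t n le_n; apply: NP => /=.
have : (N < i ^ 2 + t)%N by apply: leq_trans Ni _; nia.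
by move: (i ^ 2 + t)%N le_n => s; nia.
Qed.

Section Normality.
Variables (R : realType) (k : nat) (B : k.-tuple nat).
Local Notation Q i := (radix (level i)).
Local Notation V i := (Q i ^ level i)%N.
(* the last offset in a word at which a block of length [k] fits *)
Local Notation L i := (level i - k)%N.

Definition expected_occ i : R := i.*2.+1%:R * (L i).+1%:R / (Q i)%:R ^+ k.

Lemma expected_occ_ge0 i : 0 <= expected_occ i.
Proof. by rewrite divr_ge0 ?mulr_ge0 ?exprn_ge0. Qed.

Let Q_gt0 i : 0 < (Q i)%:R :> R.
Proof. by rewrite ltr0n. Qed.

Let V_gt0 i : 0 < (V i)%:R :> R.
Proof. by rewrite ltr0n expn_gt0. Qed.

Let natrV i : (k <= level i)%N ->
  (V i)%:R = (Q i)%:R ^+ L i * (Q i)%:R ^+ k :> R.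
Proof. by move=> k_le; rewrite -exprD subnK // natrX. Qed.

Section Counting.
Variables (rho y : R).
Local Notation tailx := (tail R bases digits).
Local Notation P n := (qprod R bases 1 n).
Local Notation digit := (cantor_digit bases y).
Hypothesis filler_fracp_y :
  \forall n \near \oo, filler n -> fracp (P n * y) = fracp (rho * tailx n).
Hypothesis filler_digit_y :
  forall K, \forall n \near \oo, filler n -> (K < digit n)%N.

Definition hit i t e : bool :=
  cylinder_left R (Q i) B
    <= fracp (rho * (Q i)%:R ^+ e / (V i)%:R *
         ((t %% V i)%:R + tailx (((i ^ 2 + t) ^ 2).-1 + level i)))
    < cylinder_left R (Q i) B + ((Q i)%:R ^+ k)^-1.

Lemma block_fits :
  \forall i \near \oo, (k <= level i)%N /\ all (fun c => c < Q i)%N B.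
Proof.
near=> i.
have : (maxn k (\max_(j < k) tnth B j) <= level i)%N.
  by near: i; move/cvgnyPge: level_cvg; exact.
rewrite geq_max => /andP[k_le max_le]; split=> //.
apply/allP => _ /tnthP[j ->]; rewrite /radix -addnn ltnS.
apply: leq_trans (leqW (leq_addr _ _)).
by apply: leq_trans max_le; exact: (leq_bigmax_cond (F := fun j => tnth B j)).
Unshelve. all: by end_near. Qed.

Lemma occurs_word :
  \forall i \near \oo, forall t e, let s := (i ^ 2 + t)%N in
  (t <= i.*2)%N -> (e <= L i)%N -> occurs B digit (s ^ 2 + e) = hit i t e.
Proof.
near=> i => t e s t_le e_le.
have [k_le B_lt] : (k <= level i)%N /\ all (fun c => c < Q i)%N B.
  by near: i; exact: block_fits.
have i_gt0 : (0 < i)%N by near: i; exact: nbhs_infty_gt.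
have s_gt0 : (0 < s)%N by rewrite addn_gt0 expn_gt0 i_gt0.
have sqrt_s : sqrtn s = i by exact: sqrtn_sqrD.
have ek_le : (e + k <= level i)%N by lia.
have fracp_p : fracp (P (s ^ 2).-1 * y) = fracp (rho * tailx (s ^ 2).-1).
  have fillerE : forall t n, (((i ^ 2 + t) ^ 2).-1 <= n)%N ->
      filler n -> fracp (P n * y) = fracp (rho * tailx n).
    by near: i; exact: near_stage.
  exact: fillerE (leqnn _) (filler_pred_sqr s_gt0).
have e_le_level : (e <= level (sqrtn s))%N by rewrite sqrt_s; lia.
have := fracp_word s_gt0 e_le_level fracp_p; rewrite sqrt_s addKn => fracpE.
have basesE j : (j < size B)%N -> bases (((s ^ 2).-1 + e).+1 + j)%N = Q i.
  rewrite size_tuple => jk; rewrite pred_sqrD // -addnA.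
  by rewrite bases_word ?sqrt_s //; lia.
have [] := cantor_block_cylinder y (isT : (0 < Q i)%N) B_lt basesE.
rewrite /hit -fracpE size_tuple => digits_hit hit_digits.
apply/forallP/idP => [occ|/hit_digits digitE j].
  apply: digits_hit => j jk.
  by have /eqP := occ (Ordinal jk); rewrite pred_sqrD // (tnth_nth 0%N).
by rewrite (tnth_nth 0%N) -pred_sqrD // digitE.
Unshelve. all: by end_near. Qed.

Hypothesis k_gt0 : (0 < k)%N.

Lemma not_occurs_filler :
  \forall i \near \oo, forall t o, let s := (i ^ 2 + t)%N in
  (t <= i.*2)%N -> (L i < o <= s.*2)%N -> ~~ occurs B digit (s ^ 2 + o).
Proof.
pose K := \max_(j < k) tnth B j; near=> i => t o s t_le /andP[L_lt o_le].
have i_gt0 : (0 < i)%N by near: i; exact: nbhs_infty_gt.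
have i_le_s : (i <= s)%N by rewrite /s; nia.
have sqrt_s : sqrtn s = i by exact: sqrtn_sqrD.
have level_le_s : (level i <= s)%N by exact: leq_trans (level_le i) i_le_s.
have l_lt : (level i - o < k)%N by lia.
have digit_gt : forall t n, (((i ^ 2 + t) ^ 2).-1 <= n)%N ->
    filler n -> (K < digit n)%N.
  by near: i; exact: near_stage.
apply/negP => /forallP/(_ (Ordinal l_lt))/eqP /= digitE.
have n_filler : filler (s ^ 2 + o + (level i - o)).
  by rewrite -addnA filler_sqrD ?sqrt_s; lia.
have n_ge : ((s ^ 2).-1 <= s ^ 2 + o + (level i - o))%N by lia.
have := digit_gt t _ n_ge n_filler; rewrite digitE ltnNge.
by rewrite (leq_bigmax_cond (F := fun j => tnth B j)).
Unshelve. all: by end_near. Qed.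

Lemma segment_occurrences :
  \forall i \near \oo, forall t, let s := (i ^ 2 + t)%N in
  (t <= i.*2)%N ->
  \sum_(0 <= o < s.*2.+1) (occurs B digit (s ^ 2 + o))%:R =
  \sum_(0 <= e < (L i).+1) (hit i t e)%:R :> R.
Proof.
apply: filterS2 occurs_word not_occurs_filler => i occE not_occ t s t_le.
have i_le_s : (i <= s)%N by rewrite /s; nia.
have level_le_s : (level i <= s)%N by exact: leq_trans (level_le i) i_le_s.
rewrite (big_cat_nat (n := (L i).+1)) ?ltnS //=; last by lia.
rewrite [X in _ + X]big_nat_cond [X in _ + X]big1 ?addr0 => [|o].
  by apply: eq_big_nat => e /andP[_ e_le]; rewrite occE.
by rewrite andbT => o_itv; rewrite (negbTE (not_occ t o t_le o_itv)).
Qed.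

Hypothesis rho_neq0 : rho != 0.

Let periods i : R := i.*2.+1%:R / (V i)%:R.

Let hit_error i e : R := 2 * ((Q i)%:R ^+ (L i - e) / `|rho|)
  + 2 * (`|rho| * (Q i)%:R ^+ e) + 4.

Lemma hit_count_period i e u :
  (k <= level i)%N -> all (fun c => c < Q i)%N B -> (e <= L i)%N ->
  `|\sum_(0 <= W < V i) (hit i (u * V i + W) e)%:R - (Q i)%:R ^+ L i|
    <= hit_error i e.
Proof.
move=> k_le B_lt e_le; have Q_neq0 := lt0r_neq0 (Q_gt0 i).
have V_neq0 := lt0r_neq0 (V_gt0 i).
pose slope := rho * (Q i)%:R ^+ e / (V i)%:R.
have slope_neq0 : slope != 0 by rewrite !mulf_neq0 ?invr_neq0 ?expf_neq0.
have norm_slope : `|slope| = `|rho| * (Q i)%:R ^+ e / (V i)%:R.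
  by rewrite !normrM normfV normrX (gtr0_norm (Q_gt0 i)) (gtr0_norm (V_gt0 i)).
pose theta W := tailx (((i ^ 2 + (u * V i + W)) ^ 2).-1 + level i).
have theta_itv W : 0 <= theta W <= 1.
  by have /andP[-> /ltW] : 0 <= theta W < 1 := tailx_itv R _.
have /andP[left_ge0] := cylinder_left_itv R (isT : (0 < Q i)%N) B_lt.
rewrite size_tuple lerBrDr => left_le.
have Qk_ge0 : 0 <= ((Q i)%:R ^+ k)^-1 :> R by rewrite invr_ge0 exprn_ge0.
have := count_fracp_linear (V i) theta_itv slope_neq0 left_ge0 Qk_ge0 left_le.
have -> : ((Q i)%:R ^+ k)^-1 * (V i)%:R = (Q i)%:R ^+ L i :> R.
  by rewrite natrV // mulrCA mulVf ?mulr1 ?expf_neq0.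
have -> : ((Q i)%:R ^+ k)^-1 / `|slope| = (Q i)%:R ^+ (L i - e) / `|rho|.
  rewrite norm_slope natrV // -[in (Q i)%:R ^+ L i](subnK e_le) exprD; field.
  by rewrite normr_eq0 rho_neq0 !expf_neq0.
have -> : `|slope| * (V i)%:R = `|rho| * (Q i)%:R ^+ e.
  by rewrite norm_slope divfK.
congr (`|_ - _| <= _); apply: eq_big_nat => W /andP[_ WV].
by rewrite /hit modnMDl modn_small.
Qed.

Lemma hit_count i e :
  (k <= level i)%N -> all (fun c => c < Q i)%N B -> (e <= L i)%N ->
  `|\sum_(0 <= t < i.*2.+1) (hit i t e)%:R - periods i * (Q i)%:R ^+ L i|
    <= periods i * hit_error i e + (Q i)%:R ^+ L i + hit_error i e.
Proof.
move=> k_le B_lt e_le; apply: sum_almost_periodic; rewrite ?exprn_ge0 //.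
- by rewrite expn_gt0.
- by move=> u; exact: hit_count_period.
- by rewrite !addr_ge0 ?mulr_ge0 ?invr_ge0 ?exprn_ge0.
Qed.

Let total_error : R := 4 / `|rho| + 4 * `|rho| + 4.

Let sum_hit_error_le i :
  \sum_(0 <= e < (L i).+1) hit_error i e <= total_error * (Q i)%:R ^+ L i.
Proof.
have rho_gt0 : 0 < `|rho| by rewrite normr_gt0.
have powers_le :
    \sum_(0 <= e < (L i).+1) (Q i)%:R ^+ e <= 2 * (Q i)%:R ^+ L i :> R.
  by apply: sum_geometric_le; rewrite (ler_nat R 2).
have -> : \sum_(0 <= e < (L i).+1) hit_error i e =
    (2 / `|rho| + 2 * `|rho|) * \sum_(0 <= e < (L i).+1) (Q i)%:R ^+ e
    + 4 * (L i).+1%:R.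
  have rev_powers : \sum_(0 <= e < (L i).+1) (Q i)%:R ^+ (L i - e) =
      \sum_(0 <= e < (L i).+1) (Q i)%:R ^+ e :> R.
    by rewrite big_nat_rev; apply: eq_big_nat => e e_lt; congr (_ ^+ _); lia.
  rewrite /hit_error big_split big_split /= sumr_const_nat subn0.
  rewrite -!mulr_sumr -mulr_suml.
  by rewrite rev_powers -[4 *+ _]mulr_natr; ring.
have L_lt : (L i).+1%:R <= (Q i)%:R ^+ L i :> R.
  by rewrite -natrX ler_nat ltn_expl.
have coef_ge0 : 0 <= 2 / `|rho| + 2 * `|rho|.
  by rewrite addr_ge0 ?mulr_ge0 ?invr_ge0 // ltW.
by have := ler_wpM2l coef_ge0 powers_le; rewrite /total_error; lra.
Qed.

Let expected_occE i : (k <= level i)%N ->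
  expected_occ i = periods i * (Q i)%:R ^+ L i * (L i).+1%:R.
Proof.
move=> k_le; rewrite /expected_occ /periods natrV //; field.
by rewrite !expf_neq0 ?lt0r_neq0.
Qed.

Lemma stage_occurrences_error : \forall i \near \oo,
  `|\sum_(i ^ 4 <= j < i.+1 ^ 4) (occurs B digit j)%:R - expected_occ i| <=
  ((periods i + 1) * total_error + (L i).+1%:R) * (Q i)%:R ^+ L i.
Proof.
apply: filterS2 block_fits segment_occurrences => i [k_le B_lt] segmentE.
rewrite sum_fourth_powers (eq_big_nat _ _
  (F2 := fun t => \sum_(0 <= e < (L i).+1) (hit i t e)%:R)); last first.
  by move=> t /andP[_ t_le]; exact: segmentE.
rewrite exchange_big /= expected_occE // mulr_natr.
rewrite -[X in _ *+ X]subn0 -sumr_const_nat -sumrB.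
apply: le_trans (ler_norm_sum _ _ _) _.
apply: le_trans (ler_sum_nat (G := fun e => periods i * hit_error i e
  + (Q i)%:R ^+ L i + hit_error i e) _) _ => [e /andP[_ e_le]|].
  exact: hit_count.
rewrite big_split big_split /= sumr_const_nat subn0 -mulr_sumr.
rewrite -[_ ^+ _ *+ _]mulr_natr.
have periods_ge0 : 0 <= periods i by rewrite divr_ge0.
have := sum_hit_error_le i.
by have := ler_wpM2l periods_ge0 (sum_hit_error_le i); lra.
Qed.

Let near_periods_ge (c : R) :
  \forall i \near \oo, c <= periods i /\ c <= (L i).+1%:R.
Proof.
near=> i; have c_le : c <= (Num.bound `|c|)%:R.
  by rewrite (le_trans (ler_norm c)) // ltW // archi_boundP.
have level_ge : (Num.bound `|c| + k <= level i)%N.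
  by near: i; move/cvgnyPge: level_cvg; exact.
split; apply: (le_trans c_le); last by rewrite ler_nat; lia.
rewrite ler_pdivlMr // -natrM ler_nat.
have bound_le : (Num.bound `|c| * V i <= level i * V i)%N.
  by rewrite leq_mul2r (leq_trans (leq_addr k _)) ?orbT.
by have := level_bound i; lia.
Unshelve. all: by end_near. Qed.

Lemma stage_occurrences :
  (fun i => \sum_(i ^ 4 <= j < i.+1 ^ 4)
    (occurs B digit j)%:R) ~_\oo expected_occ.
Proof.
apply/equivP => eps eps_gt0.
have total_error_ge0 : 0 <= total_error.
  by rewrite !addr_ge0 ?mulr_ge0 ?invr_ge0.
have large := near_periods_ge (1 + 2 / eps + 4 * total_error / eps).
apply: filterS3 stage_occurrences_error large block_fits.
move=> i error_le [periods_ge L_ge] [k_le _].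
apply: le_trans error_le _; rewrite expected_occE //.
have QL_ge0 : 0 <= (Q i)%:R ^+ L i :> R by rewrite exprn_ge0.
have inv_ge0 : 0 <= 2 / eps by rewrite divr_ge0 // ltW.
have error_ge0 : 0 <= 4 * total_error / eps.
  by rewrite divr_ge0 ?mulr_ge0 // ltW.
have periods_gt0 : 0 < periods i by lra.
have periodsQL_ge0 : 0 <= periods i * (Q i)%:R ^+ L i.
  by rewrite mulr_ge0 // ltW.
rewrite (ger0_norm (mulr_ge0 periodsQL_ge0 _)) // mulrAC mulrA ler_wpM2r //.
have L_eps_ge : 4 * total_error <= (L i).+1%:R * eps.
  by rewrite -ler_pdivrMr //; lra.
have periods_eps_ge : 2 <= periods i * eps by rewrite -ler_pdivrMr //; lra.
have := ler_wpM2l (ltW periods_gt0) L_eps_ge.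
have := ler_wpM2l (ler0n R (L i).+1) periods_eps_ge.
have : total_error <= periods i * total_error by rewrite ler_peMl //; lra.
lra.
Qed.

End Counting.

Section Weights.
Hypothesis k_gt0 : (0 < k)%N.

Let weight j : R := (qprod R bases j k)^-1.

Lemma weight_gt0 j : 0 < weight j.
Proof. by rewrite invr_gt0 prodr_gt0 // => l _; rewrite ltr0n bases_gt0. Qed.

Section SegmentWeight.
Variables i t : nat.
Hypotheses (i_ge2 : (2 <= i)%N) (k_le : (k <= level i)%N).
Hypothesis t_le : (t <= i.*2)%N.
Let s := (i ^ 2 + t)%N.

Let sqrt_s : sqrtn s = i. Proof. exact: sqrtn_sqrD. Qed.

Let i_le_s : (i <= s)%N. Proof. by rewrite /s; nia. Qed.

Let level_le_s : (level i <= s)%N.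
Proof. exact: leq_trans (level_le i) i_le_s. Qed.

Lemma word_weight o : (o <= L i)%N -> weight (s ^ 2 + o) = ((Q i)%:R ^+ k)^-1.
Proof.
move=> o_le; congr (_^-1); apply: qprod_const => j jk.
rewrite -addnA bases_word ?sqrt_s //; first by apply: leq_trans i_le_s; lia.
by lia.
Qed.

Lemma filler_weight o :
  (L i < o <= s.*2)%N -> weight (s ^ 2 + o) <= ((s ^ 2).+1`!%:R)^-1.
Proof.
move=> /andP[L_lt o_le]; have s_gt1 : (1 < s)%N by exact: leq_trans i_le_s.
have l_lt : (level i - o < k)%N by lia.
have n_gt0 : (0 < s ^ 2 + o)%N by nia.
have n_filler : filler (s ^ 2 + o + (level i - o)).
  by rewrite -addnA filler_sqrD ?sqrt_s; lia.
have inv_weight_gt0 : 0 < qprod R bases (s ^ 2 + o) k.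
  by rewrite -invr_gt0 weight_gt0.
rewrite lef_pV2 ?posrE ?ltr0n ?fact_gt0 //.
apply: le_trans (qprod_ge_factor R basic_bases n_gt0 l_lt).
by rewrite bases_filler // ler_nat leq_fact // ltnS -addnA leq_addr.
Qed.

Lemma segment_weight :
  0 <= \sum_(0 <= o < s.*2.+1) weight (s ^ 2 + o) - (L i).+1%:R / (Q i)%:R ^+ k
    <= i%:R^-1.
Proof.
have s_gt1 : (1 < s)%N by exact: leq_trans i_le_s.
rewrite (big_cat_nat (n := (L i).+1)) ?ltnS //=; last by lia.
rewrite (eq_big_nat _ _ (F2 := fun=> ((Q i)%:R ^+ k)^-1)); last first.
  by move=> o /andP[_ o_le]; exact: word_weight.
rewrite sumr_const_nat subn0 -[_ *+ (L i).+1]mulr_natl addrAC subrr add0r.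
rewrite sumr_ge0 => [/=|j _]; last exact: ltW (weight_gt0 _).
apply: (@le_trans _ _ (\sum_((L i).+1 <= o < s.*2.+1) (s ^ 2).+1`!%:R^-1)).
  by apply: ler_sum_nat => j; exact: filler_weight.
rewrite sumr_const_nat -[leLHS]mulr_natl ler_pdivrMr ?ltr0n ?fact_gt0 //.
rewrite ler_pdivlMl ?ltr0n; last by lia.
rewrite -natrM ler_nat factS; apply: (@leq_trans ((s ^ 2).+1 * (s ^ 2))).
  apply: (@leq_trans (s * s.*2.+1)); first by rewrite leq_mul // leq_subr.
  nia.
by rewrite leq_mul2l fact_geq orbT.
Qed.
End SegmentWeight.

Lemma level_mul_radix_exp_le i : (k <= level i)%N -> (level i * Q i ^ k <= i)%N.
Proof.
move=> k_le; apply: leq_trans (level_bound i).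
by rewrite leq_mul2l leq_pexp2l // orbT.
Qed.

Lemma stage_weights :
  (fun i => \sum_(i ^ 4 <= j < i.+1 ^ 4) weight j) ~_\oo expected_occ.
Proof.
apply/equivP => eps eps_gt0; near=> i.
have i_ge2 : (2 <= i)%N by near: i; exact: nbhs_infty_ge.
have i_gt0 : 0 < i%:R :> R by rewrite ltr0n; lia.
have k_le : (k <= level i)%N by near: i; move/cvgnyPge: level_cvg; exact.
have eps_le : eps^-1 <= (level i)%:R.
  apply: (@le_trans _ _ (Num.bound eps^-1)%:R).
    by rewrite ltW // archi_boundP // invr_ge0 ltW.
  by rewrite ler_nat; near: i; move/cvgnyPge: level_cvg; exact.
pose occ : R := (L i).+1%:R / (Q i)%:R ^+ k.
have Qk_gt0 : 0 < (Q i)%:R ^+ k :> R by rewrite exprn_gt0.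
have inv_le : i%:R^-1 <= eps * occ.
  rewrite /occ mulrA ler_pdivlMr // ler_pdivrMl //.
  have Qk_le_eps : (Q i)%:R ^+ k <= i%:R * eps.
    have Qk_le : (level i)%:R * (Q i)%:R ^+ k <= i%:R :> R.
      by rewrite -natrX -natrM ler_nat level_mul_radix_exp_le.
    rewrite -ler_pdivrMr // mulrC; apply: le_trans Qk_le.
    by rewrite ler_wpM2r // ltW.
  by apply: (le_trans Qk_le_eps); rewrite ler_wpM2l // ler_peMr ?ler1n // ltW.
have occ_ge0 : 0 <= occ by rewrite divr_ge0 // ltW.
have expectedE : expected_occ i = \sum_(0 <= t < i.*2.+1) occ.
  by rewrite sumr_const_nat subn0 -[RHS]mulr_natl /expected_occ /occ mulrA.
rewrite (ger0_norm (expected_occ_ge0 i)).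
rewrite sum_fourth_powers expectedE -sumrB mulr_sumr.
apply: le_trans (ler_norm_sum _ _ _) (ler_sum_nat _) => t /andP[_ t_le].
have /andP[diff_ge0 diff_le] := segment_weight i_ge2 k_le t_le.
by rewrite ger0_norm // (le_trans diff_le).
Unshelve. all: by end_near. Qed.

Lemma series_expected_occ_ge i :
  (i ^ 2)%:R / (Q i)%:R ^+ k <= series expected_occ i.
Proof.
have sum_odd n : (\sum_(0 <= j < n) j.*2.+1 = n ^ 2)%N.
  by elim: n => [|n IHn]; [rewrite big_geq|rewrite big_nat_recr //= IHn; lia].
rewrite -sum_odd natr_sum mulr_suml; apply: ler_sum_nat => j /andP[_ ji].
have Qk_gt0 n : 0 < (Q n)%:R ^+ k :> R by rewrite exprn_gt0.
apply: ler_pM; rewrite ?invr_ge0 ?(ltW (Qk_gt0 _)) //.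
  by rewrite ler_peMr ?ler1n.
rewrite lef_pV2 ?posrE // lerXn2r ?nnegrE // ler_nat.
by have := level_homo (ltnW ji); rewrite /radix; lia.
Qed.

Lemma series_expected_occ_cvg : series expected_occ @ \oo --> +oo.
Proof.
apply/cvgryPge => C; near=> i.
have C_le : C <= i%:R by near: i; exact: nbhs_infty_ger.
have : (maxn 1 k <= level i)%N by near: i; move/cvgnyPge: level_cvg; exact.
rewrite geq_max => /andP[level_ge1 k_le].
have Qk_le : (Q i ^ k <= i)%N.
  by apply: leq_trans (level_mul_radix_exp_le k_le); rewrite leq_pmull.
apply: le_trans (series_expected_occ_ge i); apply: le_trans C_le _.
by rewrite ler_pdivlMr ?exprn_gt0 // -natrX -natrM ler_nat leq_mul2l Qk_le orbT.
Unshelve. all: by end_near. Qed.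

Lemma expected_occ_small : expected_occ =o_\oo series expected_occ.
Proof.
apply/eqoP => eps eps_gt0; near=> i.
have i_ge1 : (1 <= i)%N by near: i; exact: nbhs_infty_ge.
have level_gt0 : (0 < level i)%N by near: i; move/cvgnyPge: level_cvg; exact.
have eps_le : 3 / eps <= (level i)%:R.
  apply: (@le_trans _ _ (Num.bound (3 / eps))%:R).
    by rewrite ltW // archi_boundP // divr_ge0 // ltW.
  by rewrite ler_nat; near: i; move/cvgnyPge: level_cvg; exact.
have series_ge := series_expected_occ_ge i.
have Qk_gt0 : 0 < (Q i)%:R ^+ k :> R by rewrite exprn_gt0.
rewrite !ger0_norm ?expected_occ_ge0 //; last first.
  by apply: le_trans series_ge; rewrite divr_ge0 // ltW.
apply: le_trans (ler_wpM2l (ltW eps_gt0) series_ge).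
rewrite /expected_occ mulrA ler_pM2r ?invr_gt0 //.
have count_le : (i.*2.+1 * (L i).+1 * level i <= 3 * i ^ 2)%N.
  suff : ((L i).+1 * level i <= i)%N by nia.
  apply: leq_trans (level_bound i); rewrite mulnC leq_mul2l.
  by rewrite (@leq_trans (level i).+1) ?orbT ?ltnS ?leq_subr // ltn_expl.
rewrite -(ler_pM2r (x := (level i)%:R)) ?ltr0n //.
apply: (@le_trans _ _ (3 * (i ^ 2)%:R)); first by rewrite -!natrM ler_nat.
rewrite mulrAC ler_pM2r ?ltr0n ?expn_gt0 ?i_ge1 //.
by rewrite mulrC -ler_pdivrMr.
Unshelve. all: by end_near. Qed.
End Weights.

Lemma block_frequency (rho y : R) : (0 < k)%N -> rho != 0 ->
  (\forall n \near \oo, filler n ->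
     fracp (qprod R bases 1 n * y) = fracp (rho * tail R bases digits n)) ->
  (forall K, \forall n \near \oo, filler n -> (K < cantor_digit bases y n)%N) ->
  (fun n : nat => (block_occ B (cantor_digit bases y) n)%:R / Qsum R bases k n)
    @ \oo --> (1 : R).
Proof.
move=> k_gt0 rho_neq0 filler_fracp filler_digit.
under eq_cvg do rewrite block_occ_sum.
apply: (@cvg_ratio_sum_stages _ (fun i => i ^ 4)%N stage
  expected_occ).
- by move=> i j; rewrite leq_exp2r.
- exact: stage_itv.
- exact: stage_cvg.
- exact: expected_occ_ge0.
- exact: series_expected_occ_cvg.
- exact: expected_occ_small.
- by [].
- by move=> j; exact: weight_gt0.
- exact: (stage_occurrences filler_fracp filler_digit k_gt0 rho_neq0).
- exact: stage_weights.
Qed.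
End Normality.

(** * Failure of uniform distribution *)

Section NotUniform.
Variables (R : realType) (rho y : R).
Local Notation tailx := (tail R bases digits).
Local Notation P n := (qprod R bases 1 n).
Hypothesis filler_fracp_y :
  \forall n \near \oo, filler n -> fracp (P n * y) = fracp (rho * tailx n).

Let mid n := 1 / 4 <= fracp (P n * y) < 3 / 4.
Let letter n : R := (~~ filler n)%:R.

Lemma filler_fracp_near_int :
  \forall n \near \oo, mid n -> ~~ filler n || ~~ filler n.+1.
Proof.
near=> n.
have fracpE : filler n -> fracp (P n * y) = fracp (rho * tailx n) by near: n.
have n_ge : 8 * `|rho| <= n%:R by near: n; exact: nbhs_infty_ger.
apply: contraTT; rewrite negb_or !negbK => /andP[/fracpE fracp_n].
move=> /(filler_tail_itv R) /andP[_ tail_le]; rewrite /mid fracp_n.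
rewrite (_ : 3 / 4 = 1 - 1 / 4); last by field.
apply: fracp_near_int; have /andP[tail_ge0 _] := tailx_itv R n.
rewrite normrM (ger0_norm tail_ge0).
apply: le_lt_trans (ler_wpM2l (normr_ge0 rho) tail_le) _.
by rewrite mulrA ltr_pdivrMr // -2!natr1; lra.
Unshelve. all: by end_near. Qed.

Lemma sum_letters_le u : \sum_(0 <= n < u ^ 4) letter n <= (u ^ 3)%:R.
Proof.
rewrite -[X in \sum_(X <= _ < _) _](exp0n (isT : 0 < 2)%N) (expnM u 2 2).
rewrite sum_squares //; apply: (@le_trans _ _ (\sum_(0 <= s < u ^ 2) u%:R)).
  apply: ler_sum_nat => s /andP[_ su].
  have level_le_u : (level (sqrtn s) <= u)%N.
    apply: leq_trans (level_le _) _.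
    by rewrite ltnW // ltnNge leq_sqrtn -ltnNge.
  have letterE j : (0 <= j < s.*2.+1)%N ->
      letter (s ^ 2 + j) = (j < level (sqrtn s))%N%:R.
    by move=> /andP[_ j_le]; rewrite /letter filler_sqrD // ltnNge.
  rewrite (eq_big_nat _ _ letterE) natr_sum_ltn ler_nat.
  exact: leq_trans (geq_minr _ _) level_le_u.
by rewrite sumr_const_nat subn0 -[leLHS]mulr_natl -natrM -expnSr.
Qed.

Lemma count_mid_le : exists N, forall u,
  (count mid (iota 0 (u ^ 4)))%:R <= (N + 2 * u ^ 3 + 1)%:R :> R.
Proof.
have [N _ mid_letter] := filler_fracp_near_int; exists N => u.
rewrite natr_count_iota add0n; set M := (u ^ 4)%N.
have mid_le n : (mid n)%:R <= (n < N)%N%:R + (letter n + letter n.+1) :> R.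
  have [nN|/mid_letter] := ltnP n N.
    by rewrite (@le_trans _ _ 1) ?lern1 ?leq_b1 // lerDl addr_ge0.
  rewrite add0r -natrD ler_nat; case: (mid n) => [/(_ isT)|_] //.
  by case: (filler n); case: (filler n.+1).
apply: le_trans (ler_sum_nat (fun n _ => mid_le n)) _.
rewrite !big_split /= natr_sum_ltn.
have shift_le : \sum_(0 <= n < M) letter n.+1 <= \sum_(0 <= n < M) letter n + 1.
  have : letter 0%N + \sum_(0 <= n < M) letter n.+1 =
      \sum_(0 <= n < M) letter n + letter M.
    by rewrite -big_nat_recr // -big_nat_recl.
  have : 0 <= letter 0%N by []; have : letter M <= 1 by rewrite lern1 leq_b1.
  lra.
have min_le : (minn M N)%:R <= N%:R :> R by rewrite ler_nat geq_minr.
have := sum_letters_le u; rewrite -/M !natrD natrM; lra.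
Qed.

Lemma not_distribution_normal : ~ distribution_normal_numbers bases y.
Proof.
move=> /(_ (1 / 4) (3 / 4)) /(_ ltac:(lra) ltac:(lra) ltac:(lra)) mid_cvg.
move/cvgrPdistC_le: mid_cvg => /(_ (1 / 8) ltac:(lra)) [N' _ half_le].
have [N count_le] := count_mid_le.
pose u := (N + N' + 17)%N; pose M := (u ^ 4)%N.
have u_ge : (17 <= u)%N by rewrite /u; lia.
have u_le_M : (u <= M)%N.
  by rewrite -{1}[u]expn1 leq_pexp2l // (leq_trans _ u_ge).
have M_gt0 : 0 < M%:R :> R by rewrite ltr0n expn_gt0 (leq_trans _ u_ge).
have M_large : (N' <= M)%N by apply: leq_trans u_le_M; rewrite /u; lia.
have := half_le M M_large.
rewrite -/mid; move: (count_le u); rewrite -/M.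
set mid_count := (count _ _)%:R => mid_count_le.
rewrite ler_norml => /andP[+ _].
have : mid_count / M%:R <= 1 / 4.
  rewrite ler_pdivrMr //; apply: le_trans mid_count_le _.
  rewrite mulrC mulrA ler_pdivlMr // mulr1.
  have cube_le : (17 * u ^ 3 <= M)%N by rewrite /M expnS leq_mul2r u_ge orbT.
  have u_le_cube : (u <= u ^ 3)%N.
    by rewrite -{1}[u]expn1 leq_pexp2l // (leq_trans _ u_ge).
  by rewrite -natrM ler_nat; rewrite /u in u_le_cube *; lia.
lra.
Qed.
End NotUniform.

Lemma rat_common_denom (R : realType) (r s : rat) :
  exists (d : nat) (a c : int), [/\ (0 < d)%N,
    ratr r = a%:~R / d%:R :> R & ratr s = c%:~R / d%:R :> R].
Proof.
pose m := `|denq r|%N; pose n := `|denq s|%N.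
have m_gt0 : (0 < m)%N by rewrite absz_gt0 denq_neq0.
have n_gt0 : (0 < n)%N by rewrite absz_gt0 denq_neq0.
have m_neq0 : m%:R != 0 :> R by rewrite pnatr_eq0 -lt0n.
have n_neq0 : n%:R != 0 :> R by rewrite pnatr_eq0 -lt0n.
exists (m * n)%N, (numq r * n), (numq s * m).
rewrite muln_gt0 m_gt0; split=> //.
- rewrite /ratr -[denq r]gez0_abs // -/m intrM natrM -!pmulrn.
  by field; exact/andP.
- rewrite /ratr -[denq s]gez0_abs // -/n intrM natrM -!pmulrn.
  by field; exact/andP.
Qed.

Lemma affine_normal_not_distribution_normal (R : realType) (r s : rat) :
  r != 0 ->
  (normal_numbers bases `\` distribution_normal_numbers bases)
    (ratr r * cantor_value R bases digits + ratr s).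
Proof.
move=> r_neq0; have rho_neq0 : ratr r != 0 :> R by rewrite fmorph_eq0.
have [d [a [c [d_gt0 rE sE]]]] := rat_common_denom R r s.
have filler_fracp := filler_fracp_affine d_gt0 rE sE.
split; last exact: not_distribution_normal filler_fracp.
set y := _ + _; exists (Num.floor y), (cantor_digit bases y).
split=> [|k B k_gt0]; first exact: (cantor_expansionP basic_bases).
apply: (block_frequency B k_gt0 rho_neq0 filler_fracp).
exact: (filler_digit_affine d_gt0 rho_neq0 rE sE).
Qed.

Theorem mainTheorem2 (R : realType) :
  exists (q : nat -> nat) (x : R),
    [/\ basic_sequence q,
        total_recursive q,
        computable_real x,
        0 <= x < 1
      & forall r s : rat, r != 0 ->
          (normal_numbers q `\` distribution_normal_numbers q)
            (ratr r * x + ratr s)].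
Proof.
exists bases, (cantor_value R bases digits); split.
- exact: basic_bases.
- exact: total_recursive_bases.
- exact: (computable_cantor_value R basic_bases digits_lt digits_lt_pred
    (leqnn 2) dvdn2_bases total_recursive_bases total_recursive_digits).
- exact: (cantor_value_itv R basic_bases digits_lt digits_lt_pred).
- exact: affine_normal_not_distribution_normal.
Qed.
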